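(* Let $N\ge1$, $0<s<1$ and $p=p_c=2N/(N+s)$. Let $u(x,t)\ge0$ be the semigroup solution of the Cauchy problem for $\partial_tu+\mathcal L_{s,p}u=0$ in $\mathbb R^N$ with initial datum $u_0\in L^1(\mathbb R^N)$, $u_0\ge0$. Under the further assumption that $sp_c<1$, for every $t>0$ the mass is conserved: $$\int_{\mathbb R^N}u(x,t)\,dx=\int_{\mathbb R^N}u_0(x)\,dx .$$
   Context: Let $\Phi_p(z)=|z|^{p-2}z$ and $\mathcal L_{s,p}(u)(x)=P.V.\int_{\mathbb R^N}\frac{\Phi_p(u(x)-u(y))}{|x-y|^{N+sp}}\,dy$. In $L^2(\mathbb R^N)$ it is the subdifferential of the convex functional $J(u)=\frac1{2p}\iint\frac{|u(x)-u(y)|^p}{|x-y|^{N+sp}}\,dxdy$; it generates a contraction semigroup $S_t$ which extends to an order-preserving contraction semigroup on every $L^q(\mathbb R^N)$, $1\le q<\infty$. The semigroup solution with initial data $u_0\in L^1(\mathbb R^N)$ is $u(\cdot,t)=S_tu_0$. *)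

(* Defs.v *)
From HB Require Import structures.
From mathcomp Require Import all_boot all_order all_algebra.
From mathcomp Require Import all_classical all_reals all_analysis.

Set Implicit Arguments.
Unset Strict Implicit.
Unset Printing Implicit Defensive.
Import Order.TTheory GRing.Theory Num.Theory.
Import numFieldNormedType.Exports.
Local Open Scope classical_set_scope.
Local Open Scope ring_scope.

(* Lebesgue measure on R^n, represented by n-tuples with the library's
   product sigma-algebra (the Borel sets).  The library has no such measure;
   it is built as the iterated product of [lebesgue_measure], transported along
   R * R^n ~ R^(n+1).  [lebesgue_measure_tuple_box] checks the value on boxes. *)
Section tuple_product.
Context d (T : measurableType d) (R : realType) (n : nat).
Variables (m1 : {sigma_finite_measure set T -> \bar R})
  (m2 : {sigma_finite_measure set (n.-tuple T) -> \bar R}).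

Definition tcons (x : T * n.-tuple T) : n.+1.-tuple T := [tuple of x.1 :: x.2].

Lemma measurable_tcons : measurable_fun setT tcons.
Proof. exact: measurable_cons. Qed.

Definition product_tcons : set (n.+1.-tuple T) -> \bar R :=
  pushforward (m1 \x m2)%E tcons.

Let product_tcons0 : product_tcons set0 = 0%E.
Proof. by rewrite /product_tcons /pushforward preimage_set0 measure0. Qed.

Let product_tcons_ge0 A : (0 <= product_tcons A)%E.
Proof. by rewrite /product_tcons /pushforward; exact: measure_ge0. Qed.

Let product_tcons_sigma_additive : semi_sigma_additive product_tcons.
Proof.
move=> F mF tF mUF; rewrite /product_tcons /pushforward preimage_bigcup.
apply: measure_semi_sigma_additive.
- by move=> k; rewrite -[X in measurable X]setTI; exact: measurable_tcons.
- apply/trivIsetP => /= i j _ _ ij; rewrite -preimage_setI.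
  by move/trivIsetP : tF => /(_ _ _ _ _ ij) ->//; rewrite preimage_set0.
- by rewrite -preimage_bigcup -[X in measurable X]setTI; exact: measurable_tcons.
Qed.

HB.instance Definition _ := isMeasure.Build _ _ _ product_tcons
  product_tcons0 product_tcons_ge0 product_tcons_sigma_additive.

Lemma product_tconsE (A : set T) (B : set (n.-tuple T)) :
  measurable A -> measurable B ->
  product_tcons [set x | A (thead x) /\ B [tuple of behead x]]
  = (m1 A * m2 B)%E.
Proof.
move=> mA mB; rewrite /product_tcons /pushforward -product_measure1E//.
congr ((m1 \x m2)%E _); apply/seteqP; split => -[x t] /=.
  by rewrite theadE => -[? h]; split => //; move: h; congr B; exact/val_inj.
by rewrite theadE => -[? h]; split => //; move: h; congr B; exact/val_inj.
Qed.

Let product_tcons_sigma_finite : sigma_finite setT product_tcons.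
Proof.
have /sigma_finiteP[F [TF ndF Foo]] := sigma_finiteT m1.
have /sigma_finiteP[G [TG ndG Goo]] := sigma_finiteT m2.
exists (fun k => [set x | F k (thead x) /\ G k [tuple of behead x]]).
  apply/seteqP; split => // x _.
  have [i _ Fi] : (\bigcup_i F i) (thead x) by rewrite -TF.
  have [j _ Gj] : (\bigcup_i G i) [tuple of behead x] by rewrite -TG.
  exists (maxn i j) => //; split.
    by move: Fi; exact/subsetPset/ndF/leq_maxl.
  by move: Gj; exact/subsetPset/ndG/leq_maxr.
move=> k; have [mF Fk] := Foo k; have [mG Gk] := Goo k; split.
  apply: measurableI; rewrite -[X in measurable X]setTI.
    by apply: measurable_tnth.
  by apply: measurable_behead.
by rewrite product_tconsE// lte_mul_pinfty// ge0_fin_numE.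
Qed.

HB.instance Definition _ := Measure_isSigmaFinite.Build _ _ _ product_tcons
  product_tcons_sigma_finite.

End tuple_product.

Notation euclidean R n := (n.-tuple (measurableTypeR R)).

Fixpoint lebesgue_measure_tuple (R : realType) (n : nat) :
    {sigma_finite_measure set (euclidean R n) -> \bar R} :=
  if n is m.+1 then product_tcons (@lebesgue_measure R) (lebesgue_measure_tuple R m)
  else \d_[tuple].

Lemma lebesgue_measure_tuple_box (R : realType) (n : nat)
    (A : 'I_n -> set (measurableTypeR R)) :
  (forall i, measurable (A i)) ->
  lebesgue_measure_tuple R n [set x | forall i, A i (tnth x i)]
  = (\prod_(i < n) lebesgue_measure (A i))%E.
Proof.
elim: n A => [|n IH] A mA.
  rewrite big_ord0 /= diracE (_ : _ \in _)//.
  by apply/mem_set => -[].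
rewrite big_ord_recl /= -IH; last by move=> i; exact: mA.
rewrite -product_tconsE//; last first.
  rewrite (_ : mkset _ = \bigcap_(i in [set: 'I_n])
      ((fun x : euclidean R n => tnth x i) @^-1` A (lift ord0 i))).
    apply: fin_bigcap_measurable => // i _.
    by rewrite -[X in measurable X]setTI; exact: measurable_tnth.
  by apply/seteqP; split => x /= h i; [move=> _; exact: h|exact: h].
congr (product_tcons _ _ _); apply/seteqP; split => x /=.
  move=> h; split; first exact: h.
  by move=> i; have := h (lift ord0 i); rewrite {1}(tuple_eta x) tnthS.
move=> [h0 h] i; case: (unliftP ord0 i) => [j ->|->//].
by rewrite (tuple_eta x) tnthS.
Qed.

Section gradient_flow.
Context d (T : measurableType d) (R : realType).
Variable mu : {measure set T -> \bar R}.
Implicit Types (f g : T -> R) (v : R -> T -> R) (t : R).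

Definition L1norm f : \bar R := 'N[mu]_1[EFin \o f]%E.
Definition L2norm f : \bar R := 'N[mu]_2%:E[EFin \o f]%E.

Definition subdifferential (Phi : (T -> R) -> \bar R) f g : Prop :=
  [/\ f \in Lfun mu 2%:E, g \in Lfun mu 2%:E, Phi f \is a fin_num &
    forall h : T -> R, h \in Lfun mu 2%:E ->
      (Phi f + \int[mu]_x (g x * (h x - f x))%:E <= Phi h)%E].

Definition L2_absolutely_continuous v (a b : R) : Prop :=
  forall e : R, 0 < e -> exists2 delta : R, 0 < delta &
    forall (n : nat) (I : 'I_n -> R * R),
      (forall i, a <= (I i).1 /\ (I i).1 <= (I i).2 /\ (I i).2 <= b) ->
      trivIset setT (fun i => `](I i).1, (I i).2[%classic) ->
      \sum_(i < n) ((I i).2 - (I i).1) < delta ->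
      (\sum_(i < n) L2norm (v (I i).2 \- v (I i).1)%R < e%:E)%E.

Definition is_L2_derivative v t g : Prop :=
  g \in Lfun mu 2%:E /\
  L2norm (fun x => h^-1 * (v (t + h) x - v t x) - g x) @[h --> 0^'] --> 0%E.

(* Strong solutions (in the sense of Brezis) in L^2 of v' + dPhi(v) \ni 0 on
   [0, +oo[ with v(0) = f.  When Phi is proper, convex and lower semicontinuous
   with dense domain there is exactly one (up to a.e. equality) for every f in
   L^2, and S_t f := v t is the semigroup generated by the subdifferential. *)
Definition L2_gradient_flow (Phi : (T -> R) -> \bar R) f v : Prop :=
  [/\ forall t, 0 <= t -> v t \in Lfun mu 2%:E,
      ae_eq mu setT (v 0) f,
      forall t, 0 <= t ->
        L2norm (v r \- v t) @[r --> within [set r | 0 <= r] (nbhs t)] --> 0%E,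
      forall a b : R, 0 < a -> a <= b -> L2_absolutely_continuous v a b &
      {ae @lebesgue_measure R, forall t, 0 < t ->
        exists2 g, is_L2_derivative v t g &
          subdifferential Phi (v t) (\- g)}].

(* u t = S_t u0 for the extension of S_t by density from L^1 /\ L^2 to L^1:
   u t is the L^1-limit of S_t (f n) for data f n converging to u0 in L^1. *)
Definition L1_semigroup_solution (Phi : (T -> R) -> \bar R) (u0 : T -> R)
    (u : R -> T -> R) : Prop :=
  [/\ u0 \in Lfun mu 1%E,
      forall t, 0 <= t -> u t \in Lfun mu 1%E &
      exists (f : nat -> T -> R) (v : nat -> R -> T -> R),
        [/\ forall n, f n \in Lfun mu 1%E /\ f n \in Lfun mu 2%:E,
            forall n, L2_gradient_flow Phi (f n) (v n),
            L1norm (f n \- u0) @[n --> \oo] --> 0%E &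
            forall t, 0 <= t -> L1norm (v n t \- u t) @[n --> \oo] --> 0%E]].

End gradient_flow.

Section fractional_p_laplacian.
Context (R : realType) (N : nat).
Implicit Types (x y : euclidean R N) (s p : R).

Definition eucl_dist x y : R :=
  Num.sqrt (\sum_(i < N) (tnth x i - tnth y i) ^+ 2).

(* On the diagonal the integrand is 0, as 0 `^ p = 0 for p != 0. *)
Definition gagliardo_energy s p (u : euclidean R N -> R) : \bar R :=
  ((2 * p)^-1%:E *
   \int[lebesgue_measure_tuple R N]_x \int[lebesgue_measure_tuple R N]_y
     (`|u x - u y| `^ p / eucl_dist x y `^ (N%:R + s * p))%:E)%E.

Definition semigroup_solution s p :=
  L1_semigroup_solution (lebesgue_measure_tuple R N) (gagliardo_energy s p).

End fractional_p_laplacian.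

(* Main.v *)
Require Import Defs.
From HB Require Import structures.
From mathcomp Require Import all_boot all_order all_algebra.
From mathcomp Require Import all_classical all_reals all_analysis.
From mathcomp Require Import measurable_realfun ring lra.

Set Implicit Arguments.
Unset Strict Implicit.
Unset Printing Implicit Defensive.
Import Order.TTheory GRing.Theory Num.Theory.
Import numFieldNormedType.Exports.
Local Open Scope classical_set_scope.
Local Open Scope ring_scope.

(** Why the mass is conserved.  Put q = p - 1 and alpha = s p, and let v be a
    strong solution in L2 with an integrable datum.

    The mass of v inside a large region is measured with the cutoff
    phi(x) = max(0, 1 - |x|_1 / rho).  The energy is never differentiated: the
    subgradient inequality at v, tested with v + lam phi and v - lam phi, and
    the elementary bound of [powR_expand_le] on the p-th power of a sum show,
    as lam tends to 0, that d/dt of the integral of v phi is at most twice the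
    flux, the integral of |v|^q W, where
        W(x) = int |phi(x) - phi(y)| / |x - y|^(N + alpha) dy
    ([subgradient_flux_le]).

    As phi is Lipschitz with constant of order 1 / rho and 0 < alpha < 1, a
    dyadic decomposition gives W <= C rho^(-alpha) ([tent_kernel_bound]); since
    the integrand vanishes unless x or y lies in the support of phi, symmetry
    then bounds the integral of W by a multiple of rho^(N - alpha).  For any
    theta > 0 one has |v|^q <= theta^q + theta^(q - 1) |v|.  With
    theta = delta rho^(-N), the relation N (2 - p) = s p, which says that p is
    the critical exponent, makes all powers of rho cancel, so that the flux is
    bounded in terms of the L1 norm of v, uniformly in rho >= 1.  It even tends
    to 0 as rho grows: one uses theta = 1 on a large fixed cube, where the factor
    rho^(-alpha) helps, and theta = delta rho^(-N) outside it, where v has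
    little mass ([critical_flux_split], [critical_flux_cvg0]).

    The L1 norm of v does not increase: a soft threshold contracts distances,
    hence lowers the energy, so the subgradient inequality makes the integral
    of every Huber function of v nonincreasing, and these integrals recover the
    L1 norm ([flow_integral_norm_le]).

    Both steps integrate in time an inequality that holds only at almost every
    instant.  This is legitimate because v is absolutely continuous away from
    t = 0 ([abs_continuous_le], [flow_functional_le]).  Dominated convergence
    in time now gives the conservation of mass for v ([critical_flow_mass]),
    and the semigroup solution is an L1 limit of such v. *)

(** * Absolute continuity and differential inequalities almost everywhere *)

Section absolutely_continuous_comparison.
Context (R : realType).
Implicit Types (H G : R -> R) (a b : R).

(** The scalar form of the absolute continuity that defines a strong
    solution, so that Lipschitz functionals of the solution inherit it. *)
Definition abs_continuous H a b : Prop :=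
  forall e : R, 0 < e -> exists2 delta : R, 0 < delta &
    forall (n : nat) (I : 'I_n -> R * R),
      (forall i, a <= (I i).1 /\ (I i).1 <= (I i).2 /\ (I i).2 <= b) ->
      trivIset setT (fun i => `](I i).1, (I i).2[%classic) ->
      \sum_(i < n) ((I i).2 - (I i).1) < delta ->
      \sum_(i < n) `|H (I i).2 - H (I i).1| < e.

Lemma abs_continuous_unif H a b : abs_continuous H a b ->
  forall e : R, 0 < e -> exists2 delta : R, 0 < delta &
    forall x y, a <= x -> x <= y -> y <= b -> y - x < delta ->
      `|H y - H x| < e.
Proof.
move=> AC e e0; have [delta d0 AD] := AC e e0.
exists delta => // x y ax xy yb yx.
have := AD 1%N (fun=> (x, y)); rewrite !big_ord1 /=; apply=> //.
by move=> i j _ _ _; rewrite [i]ord1 [j]ord1.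
Qed.

Lemma sum_length_le (U : set R) n (I : 'I_n -> R * R) :
  open U -> (forall i, (I i).1 <= (I i).2) ->
  (forall i, `](I i).1, (I i).2[%classic `<=` U) ->
  trivIset setT (fun i => `](I i).1, (I i).2[%classic) ->
  ((\sum_(i < n) ((I i).2 - (I i).1))%:E <= lebesgue_measure U)%E.
Proof.
move=> oU leI IU tI.
have -> : ((\sum_(i < n) ((I i).2 - (I i).1))%:E =
    \sum_(i < n) lebesgue_measure (`](I i).1, (I i).2[%classic : set R))%E.
  rewrite -sumEFin; apply: eq_bigr => i _.
  rewrite lebesgue_measure_itv /= lte_fin.
  case: ltP => // h; have := leI i => h'.
  by have -> : (I i).2 = (I i).1; [exact/le_anti/andP|rewrite subrr].
rewrite -measure_bigsetU_ord //=.
apply: le_measure; rewrite ?inE //=.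
- apply: bigsetU_measurable => i _; exact: measurable_itv.
- exact: open_measurable.
- move=> x; rewrite -bigcup_seq => -[i _]; exact: IU.
Qed.


(** Cover the exceptional null set E by an open set U whose measure is below
    the threshold delta that absolute continuity attaches to e.  Call x good
    if H x - H a is at most G x - G a + e (x - a) plus the variation of H
    over finitely many disjoint intervals of [a, x] inside U.  Good points
    form a set that is closed under suprema and can always be pushed to the
    right: by the differential inequality off E, and by one more interval in
    U on E.  Hence b is good, and the variation term is below e.  Since G is
    monotone, extending by an interval in U costs nothing on the side of G. *)
Lemma abs_continuous_le H G a b (E : set R) : a <= b ->
  abs_continuous H a b ->
  (forall x y, a <= x -> x <= y -> y <= b -> G x <= G y) ->
  lebesgue_measure.-negligible E ->
  (forall t, a <= t -> t < b -> ~ E t -> forall e, 0 < e ->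
     \forall r \near t^'+, H r - H t <= G r - G t + e * (r - t)) ->
  H b - H a <= G b - G a.
Proof.
move=> ab AC ndG [E' [mE' E'0 EE']] HG.
apply/ler_addgt0Pr => e0 e0gt0.
pose e := e0 / (b - a + 1).
have ba : 0 < b - a + 1 by lra.
have egt0 : 0 < e by rewrite divr_gt0.
have [delta d0 AD] := AC e egt0.
have [U [oU EU Ud]] : exists U : set R,
    [/\ open U, E' `<=` U & (lebesgue_measure U < delta%:E)%E].
  have E'oo : (lebesgue_measure E' < +oo)%E by rewrite E'0 ltry.
  have [U [oU EU Ud]] := lebesgue_regularity_outer mE' E'oo d0.
  exists U; split => //.
  have mU : measurable U by exact: open_measurable.
  rewrite (_ : U = E' `|` (U `\` E')); last by rewrite setDUK.
  rewrite measureU //; last 2 first.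
  - exact: measurableD.
  - by rewrite setDE setICA setICr setI0.
  by rewrite [X in (X + _)%E]E'0 add0e.
pose fam (x : R) n (I : 'I_n -> R * R) :=
  [/\ forall i, a <= (I i).1 /\ (I i).1 <= (I i).2 /\ (I i).2 <= x,
      forall i, `](I i).1, (I i).2[%classic `<=` U &
      trivIset setT (fun i => `](I i).1, (I i).2[%classic)].
pose S x := a <= x <= b /\ forall eta, 0 < eta -> exists n (I : 'I_n -> R * R),
  fam x n I /\ H x - H a <= G x - G a + e * (x - a) +
    \sum_(i < n) `|H (I i).2 - H (I i).1| + eta.
have Sa : S a.
  split; first by rewrite lexx.
  move=> eta eta0; exists 0%N, (fun=> (0, 0)); split.
    by split; [move=> [] | move=> [] | move=> []].
  rewrite big_ord0; lra.
have supS : has_sup S.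
  by split; [exists a | exists b => x [/andP[]]].
pose c := sup S.
have ac : a <= c by apply: ub_le_sup => //; exact: supS.2.
have cb : c <= b by apply: sup_le_ub; [exact: supS.1|move=> x [/andP[]]].
(* The slack eta in the definition of S absorbs the passage to the supremum,
   so that it need not be paid again at each later step. *)
have Sc : S c.
  split; first by rewrite ac cb.
  move=> eta eta0.
  have eta2 : 0 < eta / 2 by lra.
  have [d1 d10 HD] := abs_continuous_unif AC eta2.
  have [x Sx cx] := sup_adherent d10 supS.
  have xc : x <= c by apply: ub_le_sup => //; exact: supS.2.
  have [/andP[ax xb] Sx2] := Sx.
  have [n [I [[I1 I2 I3] I4]]] := Sx2 _ eta2.
  exists n, I; split.
    split => // i; have [? [? ?]] := I1 i; do 2!split => //.
    exact: le_trans xc.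
  have := HD x c ax xc cb; rewrite -/c in cx.
  have -> : c - x < d1 by rewrite ltrBlDr addrC -ltrBlDr.
  move=> /(_ isT)/ltW/ler_normlW h1.
  have h2 := ndG x c ax xc cb.
  have h3 : e * (x - a) <= e * (c - a) by rewrite ler_pM2l// lerD2r.
  lra.
have cEb : c = b.
  apply/eqP; rewrite eq_le cb /= leNgt; apply/negP => ltcb.
  suff [r [cr Sr]] : exists r, c < r /\ S r.
    by have := ub_le_sup supS.2 Sr; rewrite leNgt cr.
  have [_ Sc2] := Sc.
  have [Ec|Ec] := pselect (E c).
    have : \forall r \near c^'+, `[c, r] `<=` U.
      have := oU; rewrite openE => /(_ c (EU _ (EE' _ Ec))).
      move=> /nbhs_ballP[d /= dgt0 dU].
      near=> r => z /=; rewrite in_itv /= => /andP[cz zr].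
      apply: dU; rewrite /ball /= ler0_norm ?subr_le0// opprB.
      apply: (@le_lt_trans _ _ (r - c)); first by rewrite lerB.
      by rewrite ltrBlDr addrC; near: r; apply: nbhs_right_lt; rewrite ltrDl.
    move=> nU.
    near (c : R)^'+ => r.
    have cr : c < r by near: r; exact: nbhs_right_gt.
    have rb : r < b by near: r; exact: nbhs_right_lt.
    have rU : `[c, r] `<=` U by near: r.
    exists r; split => //; split; first by rewrite (le_trans ac (ltW cr)) ltW.
    move=> eta eta0; have [n [I [[I1 I2 I3] I4]]] := Sc2 _ eta0.
    pose J (i : 'I_n.+1) := if unlift ord_max i is Some j then I j else (c, r).
    have JJ j : J (widen_ord (leqnSn n) j) = I j.
      rewrite /J (_ : widen_ord _ j = lift ord_max j) ?liftK//.
      by apply: val_inj => /=; rewrite /bump leqNgt ltn_ord.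
    have Jmax : J ord_max = (c, r) by rewrite /J unlift_none.
    (* J appends the interval from c to r, which lies in U, to the family I. *)
    exists n.+1, J; split.
      split.
      - move=> i; rewrite /J; case: unliftP => [j _|_] /=.
          have [? [? ?]] := I1 j; do 2!split => //.
          exact: (le_trans _ (ltW cr)).
        by split => //; split => //; exact: ltW.
      - move=> i; rewrite /J; case: unliftP => [j _|_] /=; first exact: I2.
        by apply: subset_trans rU; apply: subset_itvW.
      - have dj j z : `](I j).1, (I j).2[%classic z -> `]c, r[%classic z -> False.
          rewrite /= !in_itv /= => /andP[_ h1] /andP[h2 _].
          have [_ [_ h3]] := I1 j.
          by have := lt_le_trans (lt_trans h2 h1) h3; rewrite ltxx.
        move=> i j _ _; rewrite /J.
        case: unliftP => [i' ->|->]; case: unliftP => [j' ->|->] //= [z [h1 h2]].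
        + by rewrite (I3 i' j')//; exists z.
        + by have := dj _ _ h1 h2.
        + by have := dj _ _ h2 h1.
    rewrite big_ord_recr Jmax /=.
    under eq_bigr do rewrite JJ.
    have h2 := ndG c r ac (ltW cr) (ltW rb).
    have h3 : e * (c - a) <= e * (r - a) by rewrite ler_pM2l// lerD2r ltW.
    have h4 := ler_norm (H r - H c).
    lra.
  have := HG c ac ltcb Ec e egt0 => nH.
  near (c : R)^'+ => r.
  have cr : c < r by near: r; exact: nbhs_right_gt.
  have rb : r < b by near: r; exact: nbhs_right_lt.
  have rH : H r - H c <= G r - G c + e * (r - c) by near: r.
  exists r; split => //; split; first by rewrite (le_trans ac (ltW cr)) ltW.
  move=> eta eta0; have [n [I [[I1 I2 I3] I4]]] := Sc2 _ eta0.
  exists n, I; split.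
    split => // i; have [? [? ?]] := I1 i; do 2!split => //.
    exact: (le_trans _ (ltW cr)).
  lra.
move: Sc; rewrite cEb => -[_ Sb].
apply/ler_addgt0Pr => eta eta0.
have [n [I [[I1 I2 I3] I4]]] := Sb _ eta0.
have len : \sum_(i < n) ((I i).2 - (I i).1) < delta.
  rewrite -lte_fin; apply: le_lt_trans Ud; apply: sum_length_le => // i.
  by have [_ [? _]] := I1 i.
have := AD n I I1 I3 len.
have : e0 = e * (b - a + 1) by rewrite /e mulfVK// gt_eqF.
move: I4; set s := \sum_(i < n) _.
nra.
Unshelve. all: by end_near. Qed.

End absolutely_continuous_comparison.

(** * The L2 norm as a real number *)

Section L2.
Context d (T : measurableType d) (R : realType).
Variable mu : {measure set T -> \bar R}.
Implicit Types (f g h : T -> R).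

Definition nrm2 f : R := fine (L2norm mu f).

Lemma Lfun_measurable (p : \bar R) f : f \in Lfun mu p -> measurable_fun setT f.
Proof. by move=> /andP[/[!inE]/=]. Qed.

(** Membership in L2 without the power 1/2, convenient for domination
    arguments. *)
Lemma Lfun2P f : f \in Lfun mu 2%:E <->
  measurable_fun setT f /\ (\int[mu]_x (f x ^+ 2)%:E < +oo)%E.
Proof.
split=> [f2|[mf f2]].
  split; first exact: Lfun_measurable f2.
  have /integrableP[_] := Lfun2_integrable_sqr f2.
  under eq_integral do rewrite /= ger0_norm ?sqr_ge0//.
  by [].
rewrite inE; apply/andP; split; rewrite inE//= /finite_norm unlock poweR_lty//.
under eq_integral do rewrite -?abse_EFin poweR_EFin powR_mulrn// real_normK ?num_real//.
by [].
Qed.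

Lemma Lfun2_le f g : measurable_fun setT f -> g \in Lfun mu 2%:E ->
  (forall x, `|f x| <= `|g x|) -> f \in Lfun mu 2%:E.
Proof.
move=> mf /Lfun2P[mg g2] fg; apply/Lfun2P; split => //.
apply: le_lt_trans g2; apply: ge0_le_integral => //.
- by move=> x _; rewrite lee_fin sqr_ge0.
- by apply/measurable_EFinP; exact: measurable_funX.
- by apply/measurable_EFinP; exact: measurable_funX.
- by move=> x _; rewrite lee_fin -(real_normK (num_real (f x))) -(real_normK
      (num_real (g x))) lerXn2r ?nnegrE.
Qed.

Lemma Lfun2_D f g : f \in Lfun mu 2%:E -> g \in Lfun mu 2%:E ->
  (fun x => f x + g x) \in Lfun mu 2%:E.
Proof. by move=> f2 g2; exact: (Lfun_addr_closed mu (lee1n 2)).2. Qed.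

Lemma Lfun2_Z k f : f \in Lfun mu 2%:E -> (fun x => k * f x) \in Lfun mu 2%:E.
Proof.
move=> f2; rewrite (_ : (fun x => _) = k \o* f); last by apply/funext => x; rewrite
    /= mulrC.
by apply: Lfun_scale => //; lra.
Qed.

Lemma Lfun2_B f g : f \in Lfun mu 2%:E -> g \in Lfun mu 2%:E ->
  (fun x => f x - g x) \in Lfun mu 2%:E.
Proof.
move=> f2 g2; rewrite (_ : (fun x => _) = (fun x => f x + (-1) * g x)).
  by apply: Lfun2_D => //; exact: Lfun2_Z.
by apply/funext => x; rewrite mulN1r.
Qed.

Lemma nrm2_ge0 f : 0 <= nrm2 f.
Proof. by rewrite fine_ge0// Lnorm_ge0. Qed.

Lemma L2norm_fin f : f \in Lfun mu 2%:E -> L2norm mu f = (nrm2 f)%:E.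
Proof.
move=> /andP[_]; rewrite inE /= => f2.
by rewrite /nrm2 fineK// ge0_fin_numE// Lnorm_ge0.
Qed.

Lemma Lfun2_integrableM f g : f \in Lfun mu 2%:E -> g \in Lfun mu 2%:E ->
  mu.-integrable setT (EFin \o (fun x => f x * g x)).
Proof. by move=> f2 g2; apply/Lfun1_integrable; exact: Lfun2_mul_Lfun1. Qed.

Lemma Lfun2_integrable2 f : f \in Lfun mu 2%:E ->
  mu.-integrable setT (EFin \o (fun x => f x ^+ 2)).
Proof. exact: Lfun2_integrable_sqr. Qed.

Lemma nrm2_sqr f : f \in Lfun mu 2%:E -> nrm2 f ^+ 2 = \int[mu]_x (f x ^+ 2).
Proof.
move=> f2; apply: EFin_inj; rewrite fineK; last first.
  by apply: integrable_fin_num => //; exact: Lfun2_integrable2.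
have -> : ((nrm2 f ^+ 2)%:E = (nrm2 f)%:E `^ 2)%E.
  by rewrite poweR_EFin powR_mulrn// nrm2_ge0.
rewrite -L2norm_fin// /L2norm powR_Lnorm//.
by under eq_integral do rewrite -?abse_EFin poweR_EFin powR_mulrn// real_normK
    ?num_real//.
Qed.

Lemma cauchy_schwarz f g : f \in Lfun mu 2%:E -> g \in Lfun mu 2%:E ->
  `|\int[mu]_x (f x * g x)| <= nrm2 f * nrm2 g.
Proof.
move=> f2 g2; rewrite -lee_fin EFinM -!L2norm_fin//.
have mf := Lfun_measurable f2; have mg := Lfun_measurable g2.
have h : 2^-1 + 2^-1 = 1 :> R by rewrite [RHS]splitr !div1r.
apply: le_trans (@hoelder _ _ _ mu f g 2 2 mf mg _ _ h) => //.
rewrite Lnorm1 -abse_EFin fineK; last first.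
  by apply: integrable_fin_num => //; exact: Lfun2_integrableM.
apply: le_abse_integral => //.
by apply/measurable_EFinP; exact: measurable_funM.
Qed.

Lemma nrm2_D f g : f \in Lfun mu 2%:E -> g \in Lfun mu 2%:E ->
  nrm2 (fun x => f x + g x) <= nrm2 f + nrm2 g.
Proof.
move=> f2 g2; rewrite -lee_fin EFinD -!L2norm_fin//; last exact: Lfun2_D.
apply: eminkowski; [exact: Lfun_measurable f2|exact: Lfun_measurable g2|].
by rewrite lee_fin; lra.
Qed.

Lemma nrm2_ext f g : f =1 g -> nrm2 f = nrm2 g.
Proof. by move=> /funext ->. Qed.

Lemma nrm2_Z k f : f \in Lfun mu 2%:E -> nrm2 (fun x => k * f x) = `|k| * nrm2 f.
Proof.
move=> f2; apply/eqP; rewrite -(@eqrXn2 _ 2)// ?mulr_ge0 ?nrm2_ge0//.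
rewrite exprMn !nrm2_sqr//; last exact: Lfun2_Z.
rewrite real_normK ?num_real//.
under eq_Rintegral do rewrite exprMn.
by rewrite RintegralZl//; exact: Lfun2_integrable2.
Qed.

Lemma nrm2_le f g : measurable_fun setT f -> g \in Lfun mu 2%:E ->
  (forall x, `|f x| <= `|g x|) -> nrm2 f <= nrm2 g.
Proof.
move=> mf g2 fg; have f2 := Lfun2_le mf g2 fg.
rewrite -ler_sqr ?nnegrE ?nrm2_ge0// !nrm2_sqr//.
apply: le_Rintegral => //.
- exact: Lfun2_integrable2.
- exact: Lfun2_integrable2.
- by move=> x _; rewrite -(real_normK (num_real (f x))) -(real_normK (num_real (g
      x))) lerXn2r ?nnegrE.
Qed.

Lemma nrm2_BC f g : f \in Lfun mu 2%:E -> g \in Lfun mu 2%:E ->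
  nrm2 (fun x => f x - g x) = nrm2 (fun x => g x - f x).
Proof.
move=> f2 g2; have -> : (fun x => f x - g x) = (fun x => (-1) * (g x - f x)).
  by apply/funext => x; ring.
by rewrite nrm2_Z ?normrN1 ?mul1r//; exact: Lfun2_B.
Qed.

Lemma nrm2_Bl f g : f \in Lfun mu 2%:E -> g \in Lfun mu 2%:E ->
  nrm2 f <= nrm2 g + nrm2 (fun x => f x - g x).
Proof.
move=> f2 g2; have -> : nrm2 f = nrm2 (fun x => g x + (f x - g x)).
  by apply: nrm2_ext => x; ring.
by apply: nrm2_D => //; exact: Lfun2_B.
Qed.

End L2.

(** * Functionals along an L2 gradient flow *)

Lemma cvge0_lt (R : realType) (I : Type) (F : set_system I) {FF : Filter F}
    (f : I -> \bar R) (e : R) : f x @[x --> F] --> 0%E -> 0 < e ->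
  \forall i \near F, (f i < e%:E)%E.
Proof.
move=> /fine_cvgP[ff /cvgrPdist_lt h] e0; have := h e e0.
apply: filterS2 ff => i fi; rewrite sub0r normrN => /ltr_normlW.
by rewrite -lte_fin /= fineK.
Qed.

Lemma within_continuous_itv (R : realType) (a b : R) (F : R -> R) :
  (forall t, a <= t <= b -> forall e, 0 < e -> exists2 del, 0 < del &
    forall r, a <= r <= b -> `|r - t| < del -> `|F r - F t| < e) ->
  {within `[a, b], continuous F}.
Proof.
move=> h; apply/subspace_continuousP => t /=; rewrite in_itv /= => tab.
apply/cvgrPdist_lt => e e0; have [del del0 hd] := h t tab e e0.
rewrite near_withinE; apply/nbhs_ballP; exists del => //= r; rewrite /ball /= => rt.
by rewrite in_itv /= => rab; rewrite distrC; apply: hd => //; rewrite distrC.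
Qed.

Section flow.
Context d (T : measurableType d) (R : realType).
Variable mu : {measure set T -> \bar R}.
Variables (Phi : (T -> R) -> \bar R) (f : T -> R) (v : R -> T -> R).
Hypothesis flow : L2_gradient_flow mu Phi f v.

Lemma flow_Lfun2 t : 0 <= t -> v t \in Lfun mu 2%:E.
Proof. by have [+ _ _ _ _] := flow; exact. Qed.

Lemma flow_continuous t e : 0 <= t -> 0 < e -> exists2 del, 0 < del &
  forall r, 0 <= r -> `|r - t| < del -> nrm2 mu (fun x => v r x - v t x) < e.
Proof.
move=> t0 e0; have [_ _ + _ _] := flow => /(_ t t0) /cvge0_lt /(_ e0).
rewrite near_withinE => /nbhs_ballP[del /= del0 h]; exists del => // r r0 rt.
have := h r; rewrite /ball /= distrC => /(_ rt r0).
by rewrite L2norm_fin ?lte_fin//; apply: Lfun2_B; exact: flow_Lfun2.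
Qed.

Lemma nrm2_dist r t : 0 <= r -> 0 <= t ->
  `|nrm2 mu (v r) - nrm2 mu (v t)| <= nrm2 mu (fun x => v r x - v t x).
Proof.
move=> r0 t0; have r2 := flow_Lfun2 r0; have t2 := flow_Lfun2 t0.
have h1 := nrm2_Bl r2 t2; have h2 := nrm2_Bl t2 r2.
rewrite (nrm2_BC t2 r2) in h2; rewrite ler_norml; lra.
Qed.

Lemma flow_bounded b : 0 <= b ->
  exists2 M, 0 < M & forall t, 0 <= t <= b -> nrm2 mu (v t) <= M.
Proof.
move=> b0.
have cn : {within `[0, b], continuous (fun t => nrm2 mu (v t))}.
  apply: within_continuous_itv => t /andP[t0 tb] e e0.
  have [del del0 h] := flow_continuous t0 e0; exists del => // r /andP[r0 rb] rt.
  by apply: le_lt_trans (nrm2_dist r0 t0) _; exact: h.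
have [c cb hc] := EVT_max b0 cn.
exists (nrm2 mu (v c) + 1) => [|t tb]; first by have := nrm2_ge0 mu (v c); lra.
by have := hc t; rewrite in_itv /= tb => /(_ isT); lra.
Qed.

Lemma derivative_near t g e : 0 <= t -> is_L2_derivative mu v t g -> 0 < e ->
  \forall r \near t^'+,
    nrm2 mu (fun x => (r - t)^-1 * (v r x - v t x) - g x) < e.
Proof.
move=> t0 [g2 /cvge0_lt /[apply] /nbhs_ballP[del /= del0 h]].
near=> r.
have tr : t < r by near: r; exact: nbhs_right_gt.
have rd : r < t + del by near: r; apply: nbhs_right_lt; lra.
have := h (r - t); rewrite /ball /= sub0r normrN gtr0_norm ?subr_gt0// ltrBlDl.
move=> /(_ rd); rewrite subr_eq0 gt_eqF// => /(_ isT).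
rewrite (addrC t) subrK L2norm_fin ?lte_fin//.
apply: Lfun2_B => //; apply: Lfun2_Z; apply: Lfun2_B; apply: flow_Lfun2 => //.
exact: le_trans (ltW tr).
Unshelve. all: by end_near. Qed.

Variables (Psi : R -> R) (psi : R -> T -> R) (beta : R -> R) (b M C : R).
Hypothesis b0 : 0 < b.
Hypothesis C0 : 0 <= C.
Hypothesis psiM : forall t, 0 <= t <= b ->
  psi t \in Lfun mu 2%:E /\ nrm2 mu (psi t) <= M.
Hypothesis PsiB : forall r t, 0 <= r <= b -> 0 <= t <= b ->
  Psi r - Psi t <= \int[mu]_x (psi t x * (v r x - v t x)) +
    C * nrm2 mu (fun x => v r x - v t x) ^+ 2.
Hypothesis beta0 : forall t, 0 <= t <= b -> 0 <= beta t.
Hypothesis cbeta : {within `[0, b], continuous beta}.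
Hypothesis betaP : forall t g, 0 < t < b -> is_L2_derivative mu v t g ->
  subdifferential mu Phi (v t) (\- g) -> \int[mu]_x (psi t x * g x) <= beta t.

Let flow_Lipschitz : exists2 K, 0 < K & forall r t, 0 <= r <= b -> 0 <= t <= b ->
  `|Psi r - Psi t| <= K * nrm2 mu (fun x => v r x - v t x).
Proof.
have [m m0 vm] := flow_bounded (ltW b0).
have M0 : 0 <= M.
  have [|_] := psiM (t := 0); first by rewrite lexx ltW.
  by apply: le_trans; exact: nrm2_ge0.
have Cm : 0 <= C * (2 * m) by rewrite mulr_ge0// mulr_ge0// ltW.
have K : forall r t, 0 <= r <= b -> 0 <= t <= b ->
  Psi r - Psi t <= (M + C * (2 * m) + 1) * nrm2 mu (fun x => v r x - v t x).
  move=> r t rb tb.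
  have r2 : v r \in Lfun mu 2%:E by apply: flow_Lfun2; case/andP: rb.
  have t2 : v t \in Lfun mu 2%:E by apply: flow_Lfun2; case/andP: tb.
  have [p2 pM] := psiM tb.
  apply: (le_trans (PsiB rb tb)).
  have := le_trans (ler_norm _) (cauchy_schwarz p2 (Lfun2_B r2 t2)).
  have D0 := nrm2_ge0 mu (fun x => v r x - v t x).
  have D1 : nrm2 mu (fun x => v r x - v t x) <= 2 * m.
    have := nrm2_D r2 (Lfun2_Z (-1) t2); rewrite nrm2_Z// normrN1 mul1r.
    rewrite (_ : nrm2 mu (fun x => v r x + -1 * v t x) = nrm2 mu (fun x => v r x - v
        t x)).
      by have := vm _ rb; have := vm _ tb; lra.
    by apply: nrm2_ext => x; rewrite mulN1r.
  move: (nrm2 mu (fun x => v r x - v t x)) D0 D1 => D D0 D1 h.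
  have h1 : nrm2 mu (psi t) * D <= M * D by rewrite ler_wpM2r.
  have h2 : C * D ^+ 2 <= C * (2 * m) * D by rewrite expr2 mulrA ler_wpM2r// ler_wpM2l.
  rewrite !mulrDl mul1r; lra.
exists (M + C * (2 * m) + 1) => [|r t rb tb]; first lra.
have r2 : v r \in Lfun mu 2%:E by apply: flow_Lfun2; case/andP: rb.
have t2 : v t \in Lfun mu 2%:E by apply: flow_Lfun2; case/andP: tb.
by rewrite ler_norml K// andbT lerNl opprB nrm2_BC// K.
Qed.

Let G t := \int[lebesgue_measure]_(x in `[0, t]) beta x.

Let ibeta t : t <= b -> lebesgue_measure.-integrable `[0, t] (EFin \o beta).
Proof.
move=> tb; apply: integrableS (continuous_compact_integrable (segment_compact (a :=
    0) (b := b)) cbeta) => //=.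
- by move=> x /=; rewrite !in_itv /= => /andP[-> /le_trans ->].
Qed.

Let GB r t : 0 <= t -> t <= r -> r <= b ->
  G r - G t = \int[lebesgue_measure]_(x in `]t, r]) beta x.
Proof.
move=> t0 tr rb; by rewrite /G Rintegral_itvB//; exact: ibeta.
Qed.

(** A chain rule in the form of an inequality.  The two-sided bound on the
    increments of Psi makes Psi Lipschitz along the flow, hence absolutely
    continuous; at a time where v has a derivative g, the same bound and the
    hypothesis on g give the right derivative estimate by beta.  Absolute
    continuity is only available away from 0, so the interval starts at a >
    0 and continuity of v at 0 removes a. *)
Lemma flow_functional_le : Psi b - Psi 0 <= \int[lebesgue_measure]_(x in `[0, b])
    beta x.
Proof.
have [K K0 PsiK] := flow_Lipschitz.
have itvS r t x : 0 <= t -> r <= b -> x \in `]t, r] -> 0 <= x <= b.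
  by rewrite in_itv /= => t0 rb /andP[tx xr]; rewrite (le_trans t0 (ltW tx))
      (le_trans xr).
have Gnd x y : 0 <= x -> x <= y -> y <= b -> G x <= G y.
  move=> x0 xy yb; rewrite -subr_ge0 GB//.
  apply: Rintegral_ge0 => z /= zxy; apply: beta0; exact: itvS zxy.
suff main a : 0 < a -> a < b -> Psi b - Psi a <= G b.
  apply/ler_addgt0Pr => e e0.
  have eK : 0 < e / K by rewrite divr_gt0.
  have [del del0 hd] := flow_continuous (lexx 0) eK.
  pose a := Num.min (del / 2) (b / 2).
  have a0 : 0 < a by rewrite /a lt_min !divr_gt0.
  have ab : a < b by rewrite /a gt_min; apply/orP; right; rewrite ltr_pdivrMr//
      mulr_natr mulr2n ltrDl.
  have ad : a < del by rewrite /a gt_min; apply/orP; left; rewrite ltr_pdivrMr//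
      mulr_natr mulr2n ltrDl.
  have h1 := main a a0 ab.
  have := hd a (ltW a0); rewrite subr0 gtr0_norm// => /(_ ad) h2.
  have h3 : `|Psi a - Psi 0| <= K * nrm2 mu (fun x => v a x - v 0 x).
    by apply: PsiK; rewrite ?lexx ?(ltW a0) ?(ltW ab) ?(ltW b0).
  have h4 : K * nrm2 mu (fun x => v a x - v 0 x) <= e.
    by rewrite -ler_pdivlMl// mulrC ltW.
  have := ler_norm (Psi a - Psi 0).
  rewrite /G in h1; lra.
move=> a0 ab.
have G0 t : 0 <= t -> t <= b -> 0 <= G t.
  move=> t0 tb; apply: Rintegral_ge0 => z /=; rewrite in_itv /= => /andP[z0 zt].
  by apply: beta0; rewrite z0 (le_trans zt).
suff : Psi b - Psi a <= G b - G a by have := G0 a (ltW a0) (ltW ab); lra.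
have [_ _ _ AC [E [mE E0 HE]]] := flow.
apply: (@abs_continuous_le R Psi G a b E (ltW ab)).
- move=> e e0; have eK : 0 < e / K by rewrite divr_gt0.
  have [del del0 hd] := AC a b a0 (ltW ab) _ eK.
  exists del => // n I I1 I2 I3; have := hd n I I1 I2 I3.
  have Ib i : (0 <= (I i).1 <= b) /\ (0 <= (I i).2 <= b).
    have [h1 [h2 h3]] := I1 i.
    have h4 := ltW a0.
    by split; apply/andP; split; lra.
  have I0 i : 0 <= (I i).1 /\ 0 <= (I i).2 by have [/andP[? _] /andP[? _]] := Ib i.
  under eq_bigr => i _.
    rewrite L2norm_fin; last first.
      by have [? ?] := I0 i; apply: Lfun2_B; exact: flow_Lfun2.
    over.
  rewrite sumEFin lte_fin ltr_pdivlMr// mulrC mulr_sumr.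
  apply: le_lt_trans; apply: ler_sum => i _.
  by have [? ?] := Ib i; exact: PsiK.
- by move=> x y ax xy yb; apply: Gnd => //; apply: le_trans ax; exact: ltW.
- by exists E; split.
move=> t at_ tb Et e e0.
have t0 : 0 < t by exact: lt_le_trans at_.
have [g dg sg] : exists2 g, is_L2_derivative mu v t g &
    subdifferential mu Phi (v t) (\- g).
  have : 0 < t -> exists2 g, is_L2_derivative mu v t g &
      subdifferential mu Phi (v t) (\- g).
    by apply: contrapT => h; exact: (Et (HE _ h)).
  by apply.
have t0b : 0 <= t <= b by rewrite !ltW.
have [p2 pM] := psiM t0b.
have g2 : g \in Lfun mu 2%:E by case: dg.
have v2 := flow_Lfun2 (ltW t0).
have M0 : 0 <= M by apply: le_trans pM; exact: nrm2_ge0.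
have bt : \int[mu]_x (psi t x * g x) <= beta t by apply: betaP => //; rewrite t0.
(* This eta is small enough for the error M eta caused by replacing the
   difference quotient by g, and at most 1 so that L bounds its squared
   norm. *)
pose eta := Num.min 1 (e / 4 / (M + 1)).
have eta0 : 0 < eta by rewrite lt_min ltr01 /= !divr_gt0//; lra.
have eta1 : eta <= 1 by rewrite ge_min lexx.
have etaM : M * eta <= e / 4.
  apply: (@le_trans _ _ ((M + 1) * eta)); first by rewrite ler_wpM2r ?ltW//; lra.
  by rewrite mulrC -ler_pdivlMr; [rewrite ge_min lexx orbT|lra].
have := derivative_near (ltW t0) dg eta0 => nd.
pose L := (nrm2 mu g + 1) ^+ 2.
have L0 : 0 <= L by rewrite sqr_ge0.
have CL0 : 0 <= C * L by rewrite mulr_ge0.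
have CL1 : 0 < C * L + 1 by rewrite ltr_wpDl.
have eCL : 0 < e / 4 / (C * L + 1) by rewrite !divr_gt0.
have nb : \forall r \near t^'+, (beta t - e / 4) * (r - t) <= G r - G t.
  have := cbeta; move/subspace_continuousP => /(_ t).
  rewrite /= in_itv /= t0b => /(_ isT) /cvgrPdist_lt.
  have e4 : 0 < e / 4 by lra.
  move=> /(_ _ e4); rewrite near_withinE => /nbhs_ballP[del /= del0 hd].
  near=> r.
  have tr : t < r by near: r; exact: nbhs_right_gt.
  have rb : r <= b by near: r; exact: nbhs_right_le.
  have rd : r < t + del by near: r; apply: nbhs_right_lt; lra.
  rewrite GB//; last by rewrite ltW.
  have -> : (beta t - e / 4) * (r - t) =
      \int[lebesgue_measure]_(x in `]t, r]) (cst (beta t - e / 4) x).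
    rewrite Rintegral_cst//= lebesgue_measure_itv /= lte_fin tr -EFinB /=.
    by [].
    apply: le_Rintegral => //.
    - have cc : {within `[0, b], continuous (cst (beta t - e / 4))}.
        by apply: continuous_subspaceT => x; exact: cvg_cst.
      apply: integrableS (continuous_compact_integrable (segment_compact (a := 0) (b
          := b)) cc) => //=.
      by move=> x /(itvS _ _ _ (ltW t0) rb); rewrite /= in_itv.
    - apply: integrableS (ibeta rb) => //= x /=; rewrite !in_itv /= => /andP[tx ->].
      by rewrite (le_trans (ltW t0) (ltW tx)).
    - move=> x /= xtr.
      have xb : 0 <= x <= b by apply: itvS xtr => //; exact: ltW.
      move: xtr; rewrite in_itv /= => /andP[tx xr].
      have := hd x; rewrite /ball /= ltr0_norm ?subr_lt0// opprB in_itv /= => /(_ _ xb).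
      have xd : x - t < del by lra.
      by move=> /(_ xd) /ltr_normlW h; have {h} : beta t - beta x < e / 4 := h; lra.
near=> r.
have tr : t < r by near: r; exact: nbhs_right_gt.
have rb : r <= b by near: r; exact: nbhs_right_le.
have rt0 : 0 < r - t by lra.
have r0b : 0 <= r <= b by rewrite rb (le_trans (ltW t0) (ltW tr)).
have r2 : v r \in Lfun mu 2%:E by apply: flow_Lfun2; case/andP: r0b.
have rC : r <= t + e / 4 / (C * L + 1) by near: r; apply: nbhs_right_le; rewrite ltrDl.
have CL : C * L * (r - t) <= e / 4.
  apply: (@le_trans _ _ ((C * L + 1) * (r - t))).
    by rewrite ler_wpM2r ?ltW// ltrDl.
  by rewrite mulrC -ler_pdivlMr// lerBlDl.
have := PsiB r0b t0b.
have nbr : (beta t - e / 4) * (r - t) <= G r - G t by near: r.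
have qe : nrm2 mu (fun x => (r - t)^-1 * (v r x - v t x) - g x) < eta by near: r.
pose q x := (r - t)^-1 * (v r x - v t x) - g x; rewrite -/q in qe.
have q2 : q \in Lfun mu 2%:E.
  by apply: Lfun2_B => //; apply: Lfun2_Z; apply: Lfun2_B.
have vrE x : v r x - v t x = (r - t) * g x + (r - t) * q x.
  by rewrite /q; field; rewrite gt_eqF.
have -> : \int[mu]_x (psi t x * (v r x - v t x)) =
    (r - t) * (\int[mu]_x (psi t x * g x) + \int[mu]_x (psi t x * q x)).
  have i1 := Lfun2_integrableM p2 g2; have i2 := Lfun2_integrableM p2 q2.
  rewrite -RintegralD// -RintegralZl//; last first.
    by have := integrableD measurableT i1 i2; apply: eq_integrable.
  by apply: eq_Rintegral => x _; rewrite vrE; ring.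
have h1 : \int[mu]_x (psi t x * q x) <= e / 4.
  apply: (le_trans (le_trans (ler_norm _) (cauchy_schwarz p2 q2))).
  by apply: le_trans etaM; rewrite ler_pM ?nrm2_ge0// ltW.
have h2 : nrm2 mu (fun x => v r x - v t x) ^+ 2 <= (r - t) ^+ 2 * L.
  have g1 : 0 <= nrm2 mu g + 1 by rewrite addr_ge0 ?nrm2_ge0.
  have rg : 0 <= (r - t) * (nrm2 mu g + 1) by rewrite mulr_ge0// ltW.
  rewrite /L -exprMn lerXn2r ?nnegrE ?nrm2_ge0//.
  have -> : nrm2 mu (fun x => v r x - v t x) = nrm2 mu (fun x => (r - t) * (g x + q x)).
    by apply: nrm2_ext => x; rewrite vrE -mulrDr.
  rewrite nrm2_Z ?gtr0_norm ?ler_pM2l//; last exact: Lfun2_D.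
  by apply: (le_trans (nrm2_D g2 q2)); rewrite lerD2l; lra.
have h3 : C * nrm2 mu (fun x => v r x - v t x) ^+ 2 <= e / 4 * (r - t).
  apply: (@le_trans _ _ (C * ((r - t) ^+ 2 * L))); first by rewrite ler_wpM2l.
  by rewrite (_ : C * ((r - t) ^+ 2 * L) = C * L * (r - t) * (r - t)); [rewrite
      ler_wpM2r// ltW|ring].
have h4 : (r - t) * (\int[mu]_x (psi t x * g x) + \int[mu]_x (psi t x * q x)) <= (r -
    t) * (beta t + e / 4).
  by rewrite ler_pM2l//; lra.
have h5 : 0 < e * (r - t) by rewrite mulr_gt0.
nra.
Unshelve. all: by end_near. Qed.

End flow.

(** * Huber functions and the L1 bound *)

Section huber.
Context (R : realType).
Implicit Types e r a b : R.

Definition clamp e r := Num.max (- e) (Num.min r e).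
(** With c = clamp e r this is the maximum over |c| <= e of c r - c^2 / 2:
    the quadratic r^2 / 2 up to e, continued linearly.  Its derivative is
    clamp e. *)
Definition huber e r := clamp e r * r - clamp e r ^+ 2 / 2.

Lemma clampP e r : 0 < e ->
  [\/ r <= - e /\ clamp e r = - e,
      - e <= r <= e /\ clamp e r = r | e <= r /\ clamp e r = e].
Proof.
move=> e0; rewrite /clamp.
have [h|] := boolP (r <= - e).
  by apply: Or31; split => //; rewrite min_l ?max_l//; lra.
rewrite -ltNge => h; have [re|] := boolP (r <= e).
  by apply: Or32; rewrite min_l ?max_r// ltW.
rewrite -ltNge => re; apply: Or33; split; first exact: ltW.
by rewrite min_r ?max_r//; lra.
Qed.

Lemma clamp_le e r : 0 < e -> `|clamp e r| <= `|r|.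
Proof.
move=> e0; have [[h ->]|[_ ->]|[h ->]] := clampP r e0 => //.
- by rewrite normrN gtr0_norm// ler0_norm; lra.
- by rewrite !gtr0_norm//; lra.
Qed.

Lemma soft_threshold_contraction e a b : 0 < e ->
  `|(a - clamp e a) - (b - clamp e b)| <= `|a - b|.
Proof.
move=> e0; rewrite ler_norml.
have [ab|ab] := leP a b.
- rewrite (ler0_norm (x := a - b)); last lra.
  by have [[h ->]|[/andP[h h'] ->]|[h ->]] := clampP a e0;
     have [[k ->]|[/andP[k k'] ->]|[k ->]] := clampP b e0; apply/andP; split; lra.
- rewrite (gtr0_norm (x := a - b)); last lra.
  by have [[h ->]|[/andP[h h'] ->]|[h ->]] := clampP a e0;
     have [[k ->]|[/andP[k k'] ->]|[k ->]] := clampP b e0; apply/andP; split; lra.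
Qed.

(** Write c and k for the truncations of a and b.  The three increments b -
    k, k - c, c - a all have the same sign when k and c differ, and their
    sum is b - a; so the square of b - a dominates the products of any two
    of them. *)
Lemma huber_tangent e a b : 0 < e ->
  huber e b - huber e a <= clamp e a * (b - a) + (b - a) ^+ 2.
Proof.
move=> e0; rewrite /huber; have ca := clampP a e0; have cb := clampP b e0.
move: (clamp e a) (clamp e b) ca cb => c k ca cb.
suff : (k - c) * (b - k) + (k - c) ^+ 2 / 2 <= (b - a) ^+ 2 by lra.
have -> : b - a = (k - c) + (b - k) + (c - a) by ring.
have [ck|kc|->] := ltgtP c k; last by rewrite subrr mul0r expr0n mul0r add0r sqr_ge0.
- have bk : 0 <= b - k by case: ca cb => -[h ?] [] [k1 ?]; lra.
  have ac : 0 <= c - a by case: ca cb => -[h ?] [] [k1 ?]; lra.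
  have kc0 : 0 <= k - c by rewrite subr_ge0 ltW.
  have := mulr_ge0 kc0 bk; have := mulr_ge0 kc0 ac; have := mulr_ge0 bk ac.
  nra.
- have bk : 0 <= k - b by case: ca cb => -[h ?] [] [k1 ?]; lra.
  have ac : 0 <= a - c by case: ca cb => -[h ?] [] [k1 ?]; lra.
  have kc0 : 0 <= c - k by rewrite subr_ge0 ltW.
  have := mulr_ge0 kc0 bk; have := mulr_ge0 kc0 ac; have := mulr_ge0 bk ac.
  nra.
Qed.

Lemma huber_ge0 e r : 0 < e -> 0 <= huber e r.
Proof.
move=> e0; rewrite /huber.
by have [[h ->]|[/andP[h h'] ->]|[h ->]] := clampP r e0; nra.
Qed.

Lemma huber_le_sqr e r : 0 < e -> huber e r <= r ^+ 2.
Proof.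
move=> e0; rewrite /huber.
by have [[h ->]|[/andP[h h'] ->]|[h ->]] := clampP r e0; nra.
Qed.

Lemma huber_le_norm e r : 0 < e -> huber e r <= e * `|r|.
Proof.
move=> e0; rewrite /huber.
have [r0|r0] := leP 0 r; [rewrite (ger0_norm r0)|rewrite (ltr0_norm r0)];
by have [[h ->]|[/andP[h h'] ->]|[h ->]] := clampP r e0; nra.
Qed.

Lemma huber_ge_norm e r : 0 < e -> e * `|r| - e ^+ 2 / 2 <= huber e r.
Proof.
move=> e0; rewrite /huber.
have [r0|r0] := leP 0 r; [rewrite (ger0_norm r0)|rewrite (ltr0_norm r0)];
by have [[h ->]|[/andP[h h'] ->]|[h ->]] := clampP r e0; nra.
Qed.

Lemma measurable_clamp e : measurable_fun setT (clamp e).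
Proof.
apply: measurable_maxr => //.
by apply: measurable_minr.
Qed.

Lemma measurable_huber e : measurable_fun setT (huber e).
Proof.
have mc := measurable_clamp e.
apply: measurable_funB; first exact: measurable_funM.
by apply: measurable_funM => //; exact: measurable_funX.
Qed.

End huber.

Section L1_bound.
Context d (T : measurableType d) (R : realType).
Variable mu : {measure set T -> \bar R}.
Variables (Phi : (T -> R) -> \bar R) (f : T -> R) (v : R -> T -> R).
Hypothesis flow : L2_gradient_flow mu Phi f v.
Hypothesis Phi_contraction : forall w h, w \in Lfun mu 2%:E ->
  h \in Lfun mu 2%:E -> (forall x y, `|h x - h y| <= `|w x - w y|) ->
  (Phi h <= Phi w)%E.
Hypothesis f1 : f \in Lfun mu 1%E.

Let clamp2 e w : 0 < e -> w \in Lfun mu 2%:E -> (fun x => clamp e (w x)) \in Lfun mu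
    2%:E.
Proof.
move=> e0 w2; apply: (Lfun2_le _ w2) => [|x]; last exact: clamp_le.
by apply: measurableT_comp; [exact: measurable_clamp|exact: Lfun_measurable w2].
Qed.

Let huber1 e w : 0 < e -> w \in Lfun mu 2%:E ->
  mu.-integrable setT (EFin \o (fun x => huber e (w x))).
Proof.
move=> e0 w2; apply: le_integrable (Lfun2_integrable2 w2) => //.
  apply/measurable_EFinP.
  by apply: measurableT_comp; [exact: measurable_huber|exact: Lfun_measurable w2].
move=> x _ /=; rewrite lee_fin !ger0_norm ?huber_ge0 ?sqr_ge0//.
exact: huber_le_sqr.
Qed.

(** The competitor v - clamp e v in the subgradient inequality is a soft
    threshold of v, whose energy is not larger; what remains is that the
    integral of clamp e v times dv/dt is at most 0. *)
Lemma integral_huber_le e b : 0 < e -> 0 < b ->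
  \int[mu]_x huber e (v b x) <= \int[mu]_x huber e (v 0 x).
Proof.
move=> e0 b0; have [M M0 vM] := flow_bounded flow (ltW b0).
pose psi t x := clamp e (v t x).
have psiM t : 0 <= t <= b -> psi t \in Lfun mu 2%:E /\ nrm2 mu (psi t) <= M.
  move=> tb; have t2 : v t \in Lfun mu 2%:E by apply: (flow_Lfun2 flow); case/andP: tb.
  split; first exact: clamp2.
  apply: le_trans (vM _ tb); apply: nrm2_le => // [|x]; last exact: clamp_le.
  exact: Lfun_measurable (clamp2 e0 t2).
have := @flow_functional_le _ _ _ mu Phi f v flow
  (fun t => \int[mu]_x huber e (v t x)) psi (fun=> 0) b M 1 b0 ler01 psiM.
rewrite Rintegral_cst// mul0r => h; rewrite -subr_le0; apply: h => //.
- move=> r t /andP[r0 _] /andP[t0 _].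
  have r2 := flow_Lfun2 flow r0; have t2 := flow_Lfun2 flow t0.
  have d2 := Lfun2_B r2 t2.
  have i1 := Lfun2_integrableM (clamp2 e0 t2) d2.
  have i2 := Lfun2_integrable2 d2.
  rewrite mul1r nrm2_sqr// -RintegralB ?huber1// -RintegralD//.
  apply: le_Rintegral => //.
  + by have := integrableB measurableT (huber1 e0 r2) (huber1 e0 t2); apply:
        eq_integrable.
  + by have := integrableD measurableT i1 i2; apply: eq_integrable.
  + by move=> x _; exact: huber_tangent.
- by apply: continuous_subspaceT => x; exact: cvg_cst.
- move=> t g /andP[t0 _] [g2 _] [t2 _ fin] /(_ (fun x => v t x - clamp e (v t x))).
  have h2 : (fun x => v t x - clamp e (v t x)) \in Lfun mu 2%:E.
    by apply: Lfun2_B => //; exact: clamp2.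
  move=> /(_ h2) sub.
  have i1 := Lfun2_integrableM (clamp2 e0 t2) g2.
  have : (Phi (v t) + (\int[mu]_x (psi t x * g x))%:E <= Phi (v t))%E.
    apply: le_trans (Phi_contraction t2 h2 _); last first.
      by move=> x y; exact: soft_threshold_contraction.
    apply: le_trans sub; apply: leeD2l.
    rewrite fineK; last exact: integrable_fin_num.
    rewrite le_eqVlt; apply/orP; left; apply/eqP/eq_integral => x _; congr EFin;
        rewrite /psi /=; ring.
  by rewrite -leeBrDl// subee// lee_fin.
Qed.

(** Huber functions divided by e increase to the absolute value as e tends
    to 0 and stay below it, so that Fatou's lemma transfers their decay. *)
Lemma flow_integral_norm_le b : 0 < b ->
  (\int[mu]_x `|v b x|%:E <= \int[mu]_x `|f x|%:E)%E.
Proof.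
move=> b0.
have v2 := flow_Lfun2 flow (ltW b0); have v02 := flow_Lfun2 flow (lexx 0).
have mf := Lfun_measurable f1; have mv := Lfun_measurable v2.
have mv0 := Lfun_measurable v02.
have [_ v0f _ _ _] := flow.
pose ep n : R := n.+1%:R^-1.
have ep0 n : 0 < ep n by rewrite invr_gt0.
pose F n x := ((ep n)^-1 * huber (ep n) (v b x))%:E.
have mF n : measurable_fun setT (F n).
  apply/measurable_EFinP/measurable_funM => //.
  by apply: measurableT_comp => //; exact: measurable_huber.
have F0 n x : (0 <= F n x)%E.
  by rewrite lee_fin mulr_ge0 ?huber_ge0// invr_ge0 ltW.
have Flim x : limn_einf (F ^~ x) = `|v b x|%:E.
  have cF : F ^~ x @ \oo --> `|v b x|%:E.
    apply/cvg_EFin; first exact: nearW.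
    apply: (@squeeze_cvgr _ _ _ _ (fun n => `|v b x| - ep n / 2) (fun=> `|v b x|)).
    - apply: nearW => n /=; apply/andP; split.
        rewrite -ler_pdivrMl ?invr_gt0// invrK mulrBr.
        apply: le_trans (huber_ge_norm _ (ep0 n)).
        by rewrite lerB// mulrA -expr2.
      by rewrite -ler_pdivlMl ?invr_gt0// invrK; exact: huber_le_norm.
    - rewrite -[X in _ --> X]subr0; apply: cvgB; first exact: cvg_cst.
      rewrite -[X in _ --> X](mul0r 2^-1); apply: cvgM; last exact: cvg_cst.
      exact: cvg_harmonic.
    - exact: cvg_cst.
  rewrite is_cvg_limn_einfE; last by apply/cvg_ex; exists `|v b x|%:E.
  exact/cvg_lim.
have iF n : (\int[mu]_x F n x <= \int[mu]_x `|f x|%:E)%E.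
  have en0 := ep0 n.
  rewrite /F; under eq_integral do rewrite EFinM.
  rewrite ge0_integralZl//; last 3 first.
  - apply/measurable_EFinP; apply: measurableT_comp => //; exact: measurable_huber.
  - by move=> x _; rewrite lee_fin huber_ge0.
  - by rewrite lee_fin invr_ge0 ltW.
  rewrite muleC lee_pdivrMr//.
  have -> : (\int[mu]_x (huber (ep n) (v b x))%:E =
     (\int[mu]_x huber (ep n) (v b x))%:E)%E.
    by rewrite fineK//; apply: integrable_fin_num => //; exact: huber1.
  apply: (@le_trans _ _ ((\int[mu]_x huber (ep n) (v 0 x))%:E)%E).
    by rewrite lee_fin; exact: integral_huber_le.
  rewrite fineK; last by apply: integrable_fin_num => //; exact: huber1.
  rewrite muleC -ge0_integralZl//; last 2 first.
  - by apply/measurable_EFinP; exact: measurableT_comp.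
  - by rewrite lee_fin ltW.
  apply: ae_ge0_le_integral => //.
  - by move=> x _; rewrite lee_fin huber_ge0.
  - by apply/measurable_EFinP; apply: measurableT_comp => //; exact: measurable_huber.
  - by move=> x _; rewrite -EFinM lee_fin mulr_ge0// ltW.
  - by apply/measurable_EFinP; apply: measurable_funM => //; exact: measurableT_comp.
  - by apply: filterS v0f => x /(_ I) -> _; rewrite -EFinM lee_fin huber_le_norm.
rewrite (_ : (\int[mu]_x `|v b x|%:E = \int[mu]_x limn_einf (F ^~ x))%E); last first.
  by apply: eq_integral => x _; rewrite Flim.
apply: le_trans (fatou mu measurableT mF (fun n x _ => F0 n x)) _.
rewrite limn_einf_lim; apply: lime_le; first exact: is_cvg_einfs.
apply: nearW => n; apply: le_trans (iF n).
by apply: ereal_inf_lbound; exists n => /=.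
Qed.

End L1_bound.

(** * Cutoff functions and their fractional variation *)

Lemma powR_exprn (R : realType) (b a : R) k : 0 <= b -> (b ^+ k) `^ a = (b `^ a) ^+ k.
Proof.
move=> b0; elim: k => [|k IH]; first by rewrite !expr0 powR1.
by rewrite !exprS powRM ?IH// exprn_ge0.
Qed.

Section euclidean_space.
Context (R : realType) (N : nat).
Local Notation E := (euclidean R N).
Local Notation mu := (lebesgue_measure_tuple R N).
Implicit Types (x y : E) (r rho : R).

Definition cube x r : set E :=
  [set y | forall i, `]tnth x i - r, tnth x i + r[%classic (tnth y i)].

Lemma measurable_cube x r : measurable (cube x r).
Proof.
rewrite (_ : cube x r = \bigcap_(i in [set: 'I_N])
    ((fun y : E => tnth y i) @^-1` `]tnth x i - r, tnth x i + r[)).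
  apply: fin_bigcap_measurable => // i _.
  by rewrite -[X in measurable X]setTI; exact: measurable_tnth.
by apply/seteqP; split => y /= h i; [move=> _; exact: h|exact: h].
Qed.

Lemma cube_measure x r : 0 < r -> mu (cube x r) = ((2 * r) ^+ N)%:E.
Proof.
move=> r0.
rewrite (@lebesgue_measure_tuple_box R N
    (fun i => `]tnth x i - r, tnth x i + r[%classic)); last first.
  by move=> i; exact: measurable_itv.
under eq_bigr => i _.
  rewrite lebesgue_measure_itv /= lte_fin ltrD2l gtrN// -EFinB.
  rewrite (_ : _ - _ = 2 * r); last by ring.
  over.
by rewrite prodEFin prodr_const card_ord.
Qed.

Lemma eucl_dist_ge0 x y : 0 <= eucl_dist x y.
Proof. exact: sqrtr_ge0. Qed.

Lemma eucl_distC x y : eucl_dist x y = eucl_dist y x.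
Proof.
by rewrite /eucl_dist; congr Num.sqrt; apply: eq_bigr => i _; rewrite -sqrrN opprB.
Qed.

Lemma tnth_eucl_dist x y i : `|tnth x i - tnth y i| <= eucl_dist x y.
Proof.
rewrite /eucl_dist -sqrtr_sqr ler_wsqrtr// (bigD1 i)//= lerDl.
by apply: sumr_ge0 => j _; rewrite sqr_ge0.
Qed.

Lemma eucl_dist_cube x y r : eucl_dist x y < r -> cube x r y.
Proof.
move=> h i /=; rewrite in_itv /=.
have := le_lt_trans (tnth_eucl_dist x y i) h; rewrite ltr_norml => /andP[? ?].
by apply/andP; split; lra.
Qed.

Lemma measurable_eucl_dist :
  measurable_fun setT (fun z : E * E => eucl_dist z.1 z.2).
Proof.
apply: (measurableT_comp (f := @Num.sqrt R)).
  by apply: continuous_measurable_fun; exact: sqrt_continuous.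
apply: measurable_sum => i; apply: measurable_funX; apply: measurable_funB.
  by apply: (measurableT_comp (measurable_tnth i)); exact: measurable_fst.
by apply: (measurableT_comp (measurable_tnth i)); exact: measurable_snd.
Qed.

Definition norm1 x : R := \sum_(i < N) `|tnth x i|.

Lemma norm1_dist x y : `|norm1 x - norm1 y| <= N%:R * eucl_dist x y.
Proof.
rewrite /norm1 -sumrB; apply: (le_trans (ler_norm_sum _ _ _)).
apply: (@le_trans _ _ (\sum_(i < N) eucl_dist x y)).
  apply: ler_sum => i _; apply: le_trans (tnth_eucl_dist x y i).
  exact: ler_dist_dist.
by rewrite sumr_const card_ord mulr_natl.
Qed.

Lemma measurable_norm1 : measurable_fun setT norm1.
Proof.
apply: measurable_sum => i; apply: measurableT_comp => //.
exact: measurable_tnth.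
Qed.

Lemma norm1_ge0 x : 0 <= norm1 x.
Proof. by apply: sumr_ge0. Qed.

(** The sum of the absolute values of the coordinates serves as the norm: it
    is Lipschitz for the Euclidean distance by the triangle inequality in
    each coordinate. *)
Definition tent rho x : R := Num.max 0 (1 - norm1 x / rho).

Lemma tent_ge0 rho x : 0 <= tent rho x.
Proof. by rewrite le_max lexx. Qed.

Lemma tent_le1 rho x : 0 < rho -> tent rho x <= 1.
Proof.
by move=> r0; rewrite ge_max ler01 gerBl divr_ge0 ?norm1_ge0// ltW.
Qed.

Lemma measurable_tent rho : measurable_fun setT (tent rho).
Proof.
apply: measurable_maxr => //; apply: measurable_funB => //.
by apply: measurable_funM => //; exact: measurable_norm1.
Qed.

Lemma tent_dist1 rho x y : 0 < rho -> `|tent rho x - tent rho y| <= 1.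
Proof.
move=> r0; rewrite ler_norml.
have := tent_ge0 rho x; have := tent_le1 x r0.
have := tent_ge0 rho y; have := tent_le1 y r0.
by move=> *; apply/andP; split; lra.
Qed.

Lemma tent_Lipschitz rho x y : 0 < rho ->
  `|tent rho x - tent rho y| <= N%:R * (eucl_dist x y / rho).
Proof.
move=> r0.
have h : `|norm1 x / rho - norm1 y / rho| <= N%:R * (eucl_dist x y / rho).
  rewrite -mulrBl normrM (gtr0_norm (x := rho^-1)) ?invr_gt0// mulrA.
  by rewrite ler_pM2r ?invr_gt0//; exact: norm1_dist.
apply: le_trans h; rewrite /tent; move: (norm1 x / rho) (norm1 y / rho) => a b.
have := ler_norm (a - b); have := ler_norm (b - a); rewrite (distrC b) => h1 h2.
rewrite ler_norml; have [ha|ha] := leP 0 (1 - a); have [hb|hb] := leP 0 (1 - b);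
  by apply/andP; split; lra.
Qed.

Lemma tent_cube rho x : 0 < rho -> tent rho x != 0 -> cube [tuple 0 | i < N] rho x.
Proof.
move=> r0 tx i /=; rewrite tnth_mktuple in_itv /= sub0r add0r -ltr_norml.
have : norm1 x < rho.
  rewrite ltNge; apply: contraNN tx => h; rewrite /tent; apply/eqP/max_l.
  by rewrite subr_le0 ler_pdivlMr// mul1r.
by apply: le_lt_trans; rewrite /norm1 (bigD1 i)//= lerDl; apply: sumr_ge0.
Qed.

Lemma geometric_nneseries (c z : R) : 0 <= c -> 0 <= z -> z < 1 ->
  (\sum_(k <oo) (c * z ^+ k)%:E = (c / (1 - z))%:E)%E.
Proof.
move=> c0 z0 z1; apply/cvg_lim => //.
have := @cvg_geometric_series R c z; rewrite ger0_norm// => /(_ z1) h.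
under eq_fun do rewrite sumEFin.
by apply/cvg_EFin => //; exact: nearW.
Qed.

Lemma dyadic_ge1 (D : R) : 1 <= D -> exists k, 2 ^+ k <= D < 2 ^+ k.+1.
Proof.
move=> D1; have ex : exists n, D < 2 ^+ n.
  exists (Num.bound D); apply: (lt_le_trans (archi_boundP _)); first lra.
  by rewrite -natrX ler_nat ltnW// ltn_expl.
case: (ex_minnP ex) => -[|k] h hk.
  by move: h; rewrite expr0 ltNge D1.
exists k; rewrite h andbT leNgt; apply/negP => /hk; by rewrite ltnn.
Qed.

Lemma dyadic_lt1 (D : R) : 0 < D -> D < 1 -> exists k, 2^-1 ^+ k.+1 <= D < 2^-1 ^+ k.
Proof.
move=> D0 D1; have ex : exists n, 2^-1 ^+ n <= D.
  exists (Num.bound D^-1); rewrite exprVn -[leRHS]invrK lef_pV2 ?posrE ?invr_gt0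
      ?exprn_gt0//.
  apply: ltW; apply: (lt_le_trans (archi_boundP _)); first by rewrite invr_ge0 ltW.
  by rewrite -natrX ler_nat ltnW// ltn_expl.
case: (ex_minnP ex) => -[|k] h hk.
  by move: h; rewrite expr0 leNgt D1.
exists k; rewrite h /= ltNge; apply/negP => /hk; by rewrite ltnn.
Qed.

Variable al : R.
Hypotheses (al0 : 0 < al) (al1 : al < 1).

Definition tent_kernel rho x y : R :=
  `|tent rho x - tent rho y| / eucl_dist x y `^ (N%:R + al).

Lemma tent_kernel_ge0 rho x y : 0 <= tent_kernel rho x y.
Proof. by rewrite divr_ge0// powR_ge0. Qed.

Lemma tent_kernelC rho x y : tent_kernel rho x y = tent_kernel rho y x.
Proof. by rewrite /tent_kernel distrC eucl_distC. Qed.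

Lemma measurable_tent_kernel rho :
  measurable_fun setT (fun z : E * E => tent_kernel rho z.1 z.2).
Proof.
rewrite /tent_kernel; under eq_fun do rewrite -powRN.
apply: measurable_funM.
  apply: measurableT_comp => //; apply: measurable_funB.
    exact: (measurableT_comp (measurable_tent rho) measurable_fst).
  exact: (measurableT_comp (measurable_tent rho) measurable_snd).
exact: (measurableT_comp (measurable_powR _) measurable_eucl_dist).
Qed.

(** The measure of a cube of half-side 2 r against the kernel at distance r:
    the powers of r that depend on the dimension cancel. *)
Let powN r : 0 < r -> r `^ (- (N%:R + al)) * (4 * r) ^+ N = 4 ^+ N * r `^ (- al).
Proof.
move=> r0; rewrite opprD powRD; last by rewrite (gt_eqF r0) implybT.
rewrite (powRN r N%:R) powR_mulrn ?ltW// exprMn.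
by field; rewrite expf_neq0// gt_eqF.
Qed.

(** Two dyadic scales at once: the first term dominates the kernel where 2^k
    <= |x - y| / rho < 2^(k+1), using that the cutoff varies by at most 1,
    and the second where 2^-(k+1) <= |x - y| / rho < 2^-k, using its
    Lipschitz constant. *)
Let shell rho x k (y : E) : R :=
  (2 ^+ k * rho) `^ (- (N%:R + al)) * \1_(cube x (2 ^+ k.+1 * rho)) y +
  N%:R * 2^-1 ^+ k * (2^-1 ^+ k.+1 * rho) `^ (- (N%:R + al)) *
    \1_(cube x (2^-1 ^+ k * rho)) y.

Let shell_ge0 rho x k y : 0 <= shell rho x k y.
Proof. by rewrite addr_ge0// !mulr_ge0// ?powR_ge0// exprn_ge0. Qed.

Let measurable_shell rho x k : measurable_fun setT (shell rho x k).
Proof.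
apply: measurable_funD; apply: measurable_funM => //;
  apply: measurable_indic; exact: measurable_cube.
Qed.

(** The larger of the two geometric ratios; the first is below 1 because al
    > 0, the second because al < 1. *)
Let z : R := Num.max (2 `^ (- al)) (2 `^ (al - 1)).
Let cN : R := 4 ^+ N * (1 + N%:R * 2 `^ al).

Let integral_cube (c r : R) x : 0 <= c -> 0 < r ->
  (\int[mu]_y (c * \1_(cube x r) y)%:E = (c * (2 * r) ^+ N)%:E)%E.
Proof.
move=> c0 r0; under eq_integral do rewrite EFinM.
rewrite ge0_integralZl//.
- rewrite integral_indic//; last exact: measurable_cube.
  by rewrite setIT [X in (_ * X)%E](cube_measure x r0).
- by apply/measurable_EFinP; apply: measurable_indic; exact: measurable_cube.
Qed.

Let z_ge0 : 0 <= z. Proof. by rewrite le_max powR_ge0. Qed.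

Let z_lt1 : z < 1.
Proof.
have l2 : 0 < ln (2 : R) by rewrite ln_gt0// ltr1n.
have h (a : R) : a < 0 -> 2 `^ a < 1.
  by move=> a0; rewrite /powR gt_eqF// expR_lt1 nmulr_rlt0.
by rewrite gt_max !h// ?oppr_lt0// subr_lt0.
Qed.

Let integral_shell rho x k : 0 < rho ->
  (\int[mu]_y (shell rho x k y)%:E <= (cN * rho `^ (- al) * z ^+ k)%:E)%E.
Proof.
move=> r0.
have k0 : 0 < 2 ^+ k * rho by rewrite mulr_gt0// exprn_gt0.
have j0 : 0 < 2^-1 ^+ k.+1 * rho by rewrite mulr_gt0// exprn_gt0// invr_gt0.
have k1 : 0 < 2 ^+ k.+1 * rho by rewrite mulr_gt0// exprn_gt0.
have j1 : 0 < 2^-1 ^+ k * rho by rewrite mulr_gt0// exprn_gt0// invr_gt0.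
have c2 : 0 <= N%:R * 2^-1 ^+ k * (2^-1 ^+ k.+1 * rho) `^ (- (N%:R + al)).
  by rewrite !mulr_ge0 ?powR_ge0// exprn_ge0// invr_ge0.
under eq_integral do rewrite EFinD.
rewrite ge0_integralD//; last 4 first.
- by move=> y _; rewrite lee_fin mulr_ge0// powR_ge0.
- apply/measurable_EFinP; apply: measurable_funM => //.
  by apply: measurable_indic; exact: measurable_cube.
- by move=> y _; rewrite lee_fin mulr_ge0.
- apply/measurable_EFinP; apply: measurable_funM => //.
  by apply: measurable_indic; exact: measurable_cube.
rewrite !integral_cube ?powR_ge0// -EFinD lee_fin.
have -> : 2 * (2 ^+ k.+1 * rho) = 4 * (2 ^+ k * rho) by rewrite exprS; ring.
have -> : 2 * (2^-1 ^+ k * rho) = 4 * (2^-1 ^+ k.+1 * rho).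
  by rewrite exprS; field.
rewrite -[N%:R * _ * _ * _]mulrA !powN// !powRM ?exprn_ge0 ?invr_ge0 ?(ltW r0)//.
rewrite !powR_exprn ?invr_ge0//.
have half : 2^-1 `^ (- al) = 2 `^ al :> R.
  by rewrite -(powR_inv1 (ler0n R 2)) -powRrM mulN1r opprK.
have e2 : 2^-1 ^+ k * (2^-1 `^ (- al)) ^+ k.+1 = 2 `^ al * (2 `^ (al - 1)) ^+ k :> R.
  have -> : 2 `^ (al - 1) = 2 `^ al * 2^-1 :> R.
    by rewrite powRD ?pnatr_eq0 ?implybT// powR_inv1.
  by rewrite half exprS exprMn mulrCA [X in _ * X]mulrC.
have -> : N%:R * 2^-1 ^+ k * (4 ^+ N * ((2^-1 `^ (- al)) ^+ k.+1 * rho `^ (- al))) =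
   N%:R * 4 ^+ N * rho `^ (- al) * (2^-1 ^+ k * (2^-1 `^ (- al)) ^+ k.+1) by ring.
rewrite e2 /cN.
have h1 : (2 `^ (- al)) ^+ k <= z ^+ k by rewrite lerXn2r ?nnegrE ?powR_ge0// le_max
    lexx.
have h2 : (2 `^ (al - 1)) ^+ k <= z ^+ k by rewrite lerXn2r ?nnegrE ?powR_ge0//
    le_max lexx orbT.
have -> : 4 ^+ N * (1 + N%:R * 2 `^ al) * rho `^ (- al) * z ^+ k =
  4 ^+ N * (z ^+ k * rho `^ (- al)) + N%:R * 4 ^+ N * rho `^ (- al) * (2 `^ al * z ^+
      k).
  by ring.
apply: lerD.
  by rewrite ler_wpM2l ?exprn_ge0// ler_wpM2r ?powR_ge0.
by rewrite ler_wpM2l ?mulr_ge0 ?powR_ge0 ?exprn_ge0// ler_wpM2l ?powR_ge0.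
Qed.

Let kernel_shell rho x y : 0 < rho -> exists k, tent_kernel rho x y <= shell rho x k y.
Proof.
move=> r0.
have [xy|xy] := eqVneq (eucl_dist x y) 0.
  exists 0%N; rewrite /tent_kernel xy powR0; first by rewrite invr0 mulr0 shell_ge0.
  by rewrite gt_eqF// ltr_wpDl.
have d0 : 0 < eucl_dist x y by rewrite lt_def xy eucl_dist_ge0.
pose D := eucl_dist x y / rho.
have D0 : 0 < D by rewrite divr_gt0.
have dD : eucl_dist x y = D * rho by rewrite mulfVK// gt_eqF.
have pw (r : R) : 0 < r -> r <= eucl_dist x y ->
    (eucl_dist x y `^ (N%:R + al))^-1 <= r `^ (- (N%:R + al)).
  move=> rr rd; rewrite powRN lef_pV2 ?posrE ?powR_gt0//.
  by apply: ge0_ler_powR; rewrite ?nnegrE ?addr_ge0// ltW.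
have [D1|D1] := leP 1 D.
- have [k /andP[k1 k2]] := dyadic_ge1 D1; exists k.
  have r1 : 0 < 2 ^+ k * rho by rewrite mulr_gt0// exprn_gt0.
  rewrite /shell indicE mem_set; last first.
    by apply: eucl_dist_cube; rewrite dD ltr_pM2r.
  rewrite mulr1; apply: ler_wpDr.
    by rewrite !mulr_ge0 ?powR_ge0// exprn_ge0// invr_ge0.
  apply: (@le_trans _ _ (1 * (2 ^+ k * rho) `^ (- (N%:R + al)))); last by rewrite mul1r.
  apply: ler_pM => //; first by rewrite invr_ge0 powR_ge0.
    exact: tent_dist1.
  by apply: pw => //; rewrite dD ler_pM2r.
- have [k /andP[k1 k2]] := dyadic_lt1 D0 D1; exists k.
  have r1 : 0 < 2^-1 ^+ k.+1 * rho by rewrite mulr_gt0// exprn_gt0// invr_gt0.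
  rewrite /shell [X in _ + _ * X]indicE mem_set; last first.
    by apply: eucl_dist_cube; rewrite dD ltr_pM2r.
  rewrite mulr1; apply: ler_wpDl; first by rewrite mulr_ge0// powR_ge0.
  apply: ler_pM => //; first by rewrite invr_ge0 powR_ge0.
    apply: (le_trans (tent_Lipschitz _ _ r0)).
    by rewrite ler_wpM2l// ltW.
  by apply: pw => //; rewrite dD ler_pM2r.
Qed.

(** Summing the shells costs two geometric series, one for large distances,
    convergent since al > 0, and one for small distances, convergent since
    al < 1.  The measure of a cube does not depend on its centre, whence the
    uniformity in x. *)
Lemma tent_kernel_bound : exists2 C : R, 0 < C & forall rho, 0 < rho -> forall x,
  (\int[mu]_y (tent_kernel rho x y)%:E <= (C * rho `^ (- al))%:E)%E.
Proof.
have cN0 : 0 < cN.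
  by rewrite /cN mulr_gt0 ?exprn_gt0// ltr_pwDl// mulr_ge0// powR_ge0.
exists (cN / (1 - z)) => [|rho r0 x]; first by rewrite divr_gt0// subr_gt0.
apply: (@le_trans _ _ (\int[mu]_y \sum_(k <oo) (shell rho x k y)%:E)%E).
  apply: ge0_le_integral => //.
  - by move=> y _; rewrite lee_fin tent_kernel_ge0.
  - apply/measurable_EFinP.
    exact: (measurableT_comp (measurable_tent_kernel rho) (pair1_measurable x)).
  - apply: ge0_emeasurable_sum => [k y _ _|k _]; first by rewrite lee_fin shell_ge0.
    by apply/measurable_EFinP; exact: measurable_shell.
  - move=> y _; have [k hk] := kernel_shell x y r0.
    apply: (@le_trans _ _ (shell rho x k y)%:E); first by rewrite lee_fin.
    rewrite (@nneseriesD1 _ _ k)//; last by move=> *; rewrite lee_fin shell_ge0.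
    by rewrite leeDl// nneseries_ge0// => *; rewrite lee_fin shell_ge0.
rewrite integral_nneseries//; last 2 first.
- by move=> k; apply/measurable_EFinP; exact: measurable_shell.
- by move=> k y _; rewrite lee_fin shell_ge0.
have -> : cN / (1 - z) * rho `^ (- al) = cN * rho `^ (- al) / (1 - z) by rewrite mulrAC.
rewrite -geometric_nneseries ?z_ge0 ?z_lt1//; last by rewrite mulr_ge0 ?powR_ge0// ltW.
apply: lee_nneseries => [k _ _|k _]; last exact: integral_shell.
by apply: integral_ge0 => y _; rewrite lee_fin shell_ge0.
Qed.

End euclidean_space.

(** * Iterated integrals of a symmetric kernel *)

Section iterated_integral.
Context d (T : measurableType d) (R : realType).
Variable mu : {sigma_finite_measure set T -> \bar R}.
Implicit Types f g : T -> T -> R.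

Definition integral2 f : \bar R := (\int[mu]_x \int[mu]_y (f x y)%:E)%E.

Definition measurable2 f := measurable_fun setT (fun z : T * T => f z.1 z.2).

Lemma measurable2_section f x : measurable2 f ->
  measurable_fun setT (fun y => (f x y)%:E).
Proof.
by move=> mf; apply/measurable_EFinP; exact: (measurableT_comp mf (pair1_measurable x)).
Qed.

Lemma measurable2_integral f : measurable2 f -> (forall x y, 0 <= f x y) ->
  measurable_fun setT (fun x => \int[mu]_y (f x y)%:E)%E.
Proof.
move=> mf f0.
apply: (@measurable_fun_fubini_tonelli_F _ _ _ _ _ mu (fun z : T * T => (f z.1
    z.2)%:E)).
  exact/measurable_EFinP.
by move=> z; rewrite lee_fin.
Qed.

Lemma integral2_le f g : measurable2 f -> measurable2 g ->
  (forall x y, 0 <= f x y) -> (forall x y, f x y <= g x y) ->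
  (integral2 f <= integral2 g)%E.
Proof.
move=> mf mg f0 fg.
have g0 x y : 0 <= g x y by exact: le_trans (f0 x y) (fg x y).
apply: ge0_le_integral => //.
- by move=> x _; apply: integral_ge0 => y _; rewrite lee_fin.
- exact: measurable2_integral.
- exact: measurable2_integral.
- move=> x _; apply: ge0_le_integral => //.
  + by move=> y _; rewrite lee_fin.
  + exact: measurable2_section.
  + exact: measurable2_section.
  + by move=> y _; rewrite lee_fin.
Qed.

Lemma integral2D f g : measurable2 f -> measurable2 g ->
  (forall x y, 0 <= f x y) -> (forall x y, 0 <= g x y) ->
  integral2 (fun x y => f x y + g x y) = (integral2 f + integral2 g)%E.
Proof.
move=> mf mg f0 g0; rewrite /integral2 -ge0_integralD//.
- apply: eq_integral => x _; under eq_integral do rewrite EFinD.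
  rewrite ge0_integralD//.
  + by move=> y _; rewrite lee_fin.
  + exact: measurable2_section.
  + by move=> y _; rewrite lee_fin.
  + exact: measurable2_section.
- by move=> x _; apply: integral_ge0 => y _; rewrite lee_fin.
- exact: measurable2_integral.
- by move=> x _; apply: integral_ge0 => y _; rewrite lee_fin.
- exact: measurable2_integral.
Qed.

Lemma integral2_swap f : measurable2 f -> (forall x y, 0 <= f x y) ->
  integral2 f = integral2 (fun x y => f y x).
Proof.
move=> mf f0.
apply: (fubini_tonelli (fun z : T * T => (f z.1 z.2)%:E)) => /=.
  exact/measurable_EFinP.
by move=> z; rewrite lee_fin.
Qed.

End iterated_integral.

Section symmetric_kernel.
Context d (T : measurableType d) (R : realType).
Variable mu : {sigma_finite_measure set T -> \bar R}.
Variables (K : T -> T -> R) (c : R).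
Hypothesis c0 : 0 <= c.
Hypothesis K0 : forall x y, 0 <= K x y.
Hypothesis KC : forall x y, K x y = K y x.
Hypothesis mK : measurable2 K.
Hypothesis Kc : forall x, (\int[mu]_y (K x y)%:E <= c%:E)%E.

Definition kernel_mass x : R := \int[mu]_y K x y.
Local Notation W := kernel_mass.

Lemma kernel_massE x : (\int[mu]_y (K x y)%:E = (W x)%:E)%E.
Proof.
rewrite fineK// ge0_fin_numE; last by apply: integral_ge0 => y _; rewrite lee_fin.
by apply: (le_lt_trans (Kc x)); rewrite ltry.
Qed.

Lemma kernel_mass_ge0 x : 0 <= W x.
Proof. by apply: Rintegral_ge0 => y _. Qed.

Lemma kernel_mass_le x : W x <= c.
Proof. by rewrite -lee_fin -kernel_massE. Qed.

Lemma measurable_kernel_mass : measurable_fun setT W.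
Proof.
apply/measurable_EFinP.
have := measurable2_integral mu mK K0.
by under eq_fun do rewrite kernel_massE.
Qed.

Lemma measurable_kernel_l (u : T -> R) : measurable_fun setT u ->
  measurable2 (fun x y => K x y * u x).
Proof.
by move=> meas_u; apply: measurable_funM => //; exact: (measurableT_comp meas_u
    measurable_fst).
Qed.

Lemma measurable_kernel_r (u : T -> R) : measurable_fun setT u ->
  measurable2 (fun x y => K x y * u y).
Proof.
by move=> meas_u; apply: measurable_funM => //; exact: (measurableT_comp meas_u
    measurable_snd).
Qed.

Lemma integral_kernel_l (u : T -> R) : measurable_fun setT u ->
  (forall x, 0 <= u x) ->
  integral2 mu (fun x y => K x y * u x) = (\int[mu]_x (u x * W x)%:E)%E.
Proof.
move=> meas_u u0; apply: eq_integral => x _.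
under eq_integral do rewrite mulrC EFinM.
rewrite ge0_integralZl ?lee_fin ?kernel_massE ?EFinM//.
  exact: measurable2_section.
by move=> y _; rewrite lee_fin.
Qed.

Lemma integral_kernel_r (u : T -> R) : measurable_fun setT u ->
  (forall x, 0 <= u x) ->
  integral2 mu (fun x y => K x y * u y) = (\int[mu]_x (u x * W x)%:E)%E.
Proof.
move=> meas_u u0; rewrite integral2_swap; last 2 first.
- exact: measurable_kernel_r.
- by move=> x y; rewrite mulr_ge0.
rewrite -integral_kernel_l//.
by apply: eq_integral => x _; apply: eq_integral => y _; rewrite (KC x y).
Qed.

(** If the kernel vanishes off the pairs that meet S, it is at most its own
    restrictions to x in S and to y in S, which have equal integrals by
    symmetry. *)
Lemma integral_kernel_mass_le (S : set T) (m : R) : measurable S ->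
  (mu S <= m%:E)%E -> (forall x y, ~ S x -> ~ S y -> K x y = 0) ->
  (\int[mu]_x (W x)%:E <= (2 * (c * m))%:E)%E.
Proof.
move=> mS Sm KS.
have mi : measurable_fun setT (\1_S : T -> R) by exact: measurable_indic.
have i0 x : 0 <= (\1_S x : R) by [].
have mW := measurable_kernel_mass.
have h : (\int[mu]_x ((\1_S x) * W x)%:E <= (c * m)%:E)%E.
  apply: (@le_trans _ _ (\int[mu]_x (c%:E * (\1_S x)%:E))%E).
    apply: ge0_le_integral => //.
    - by move=> x _; rewrite lee_fin mulr_ge0// kernel_mass_ge0.
    - by apply/measurable_EFinP; exact: measurable_funM.
    - by apply/measurable_EFinP; exact: measurable_funM.
    - by move=> x _; rewrite -EFinM lee_fin mulrC ler_wpM2r// kernel_mass_le.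
  rewrite ge0_integralZl//; last exact/measurable_EFinP.
  by rewrite integral_indic// setIT EFinM lee_wpmul2l.
apply: (@le_trans _ _ (integral2 mu (fun x y => K x y * \1_S x + K x y * \1_S y))).
  rewrite (_ : (\int[mu]_x (W x)%:E)%E = integral2 mu K); last first.
    by apply: eq_integral => x _; rewrite kernel_massE.
  apply: integral2_le => //.
    by apply: measurable_funD; [exact: measurable_kernel_l|exact: measurable_kernel_r].
  move=> x y; rewrite -mulrDr.
  have [Sx|Sx] := pselect (S x).
    by rewrite indicE mem_set// ler_peMr// lerDl.
  have [Sy|Sy] := pselect (S y).
    by rewrite [X in _ + X]indicE mem_set// ler_peMr// lerDr.
  by rewrite KS// mul0r.
rewrite integral2D; last 4 first.
- exact: measurable_kernel_l.
- exact: measurable_kernel_r.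
- by move=> x y; rewrite mulr_ge0.
- by move=> x y; rewrite mulr_ge0.
rewrite integral_kernel_l// integral_kernel_r// mulr2n mulrDl mul1r EFinD.
exact: leeD.
Qed.

End symmetric_kernel.

(** * The flux through a cutoff function *)

Section powR_inequalities.
Context (R : realType).
Implicit Types a b p q : R.

(** Concavity in multiplicative form: (c / (a + b))^q >= c / (a + b) for c =
    a and c = b. *)
Lemma powRD_le a b q : 0 <= a -> 0 <= b -> 0 < q -> q <= 1 ->
  (a + b) `^ q <= a `^ q + b `^ q.
Proof.
move=> a0 b0 q0 q1; have [ab0|ab0] := eqVneq (a + b) 0.
  by rewrite ab0 powR0 ?gt_eqF// addr_ge0 ?powR_ge0.
have S0 : 0 < a + b by rewrite lt_def ab0 addr_ge0.
have h (c : R) : 0 <= c -> c <= a + b -> (a + b) `^ q * (c / (a + b)) <= c `^ q.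
  move=> c0 cS; have [->|cn0] := eqVneq c 0; first by rewrite mul0r mulr0 powR_ge0.
  have cp : 0 < c by rewrite lt_def cn0.
  have -> : c `^ q = (a + b) `^ q * (c / (a + b)) `^ q.
    rewrite -powRM ?(ltW S0) ?(ltW (divr_gt0 cp S0))//; congr (_ `^ _); field.
    by rewrite gt_eqF.
  rewrite ler_pM2l ?powR_gt0//; apply: ger1_powR => //.
  by rewrite divr_gt0//= ler_pdivrMr// mul1r.
apply: le_trans (lerD (h a a0 _) (h b b0 _)); rewrite ?lerDl ?lerDr//.
by rewrite -mulrDr -mulrDl mulfV// mulr1.
Qed.

(** The p-th power is expanded as (a + b)(a + b)^(p - 1) and the factor (a +
    b)^(p - 1) is estimated by concavity; a bound of first order in b is all
    that the test of the subgradient inequality requires. *)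
Lemma powR_expand_le a b p : 0 <= a -> 0 <= b -> 1 < p -> p < 2 ->
  (a + b) `^ p <= a `^ p + b * (2 * a `^ (p - 1) + b `^ (p - 1)).
Proof.
move=> a0 b0 p1 p2; have p0 : 0 < p by lra.
have q0 : 0 < p - 1 by lra.
have q1 : p - 1 <= 1 by lra.
rewrite -(mulr_powRB1 (addr_ge0 a0 b0) p0) -(mulr_powRB1 a0 p0) mulrDl.
have h1 : a * (a + b) `^ (p - 1) <= a * a `^ (p - 1) + b * a `^ (p - 1).
  have [->|an0] := eqVneq a 0; first by rewrite !mul0r add0r mulr_ge0// powR_ge0.
  have ap : 0 < a by rewrite lt_def an0.
  have -> : a + b = a * (1 + b / a) by field.
  have ba : 0 <= b / a by rewrite divr_ge0.
  rewrite powRM ?addr_ge0//.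
  have h : (1 + b / a) `^ (p - 1) <= 1 + b / a by apply: ler1_powR => //; rewrite lerDl.
  have -> : a * a `^ (p - 1) + b * a `^ (p - 1) = a * (a `^ (p - 1) * (1 + b / a)) by
      field.
  by rewrite ler_pM2l// ler_wpM2l// powR_ge0.
have h2 : b * (a + b) `^ (p - 1) <= b * (a `^ (p - 1) + b `^ (p - 1)).
  by rewrite ler_wpM2l// powRD_le.
by apply: le_trans (lerD h1 h2) _; rewrite le_eqVlt; apply/orP; left; apply/eqP; ring.
Qed.

Lemma powR_le_sqr a q : 0 <= a -> 0 < q -> q <= 1 -> a `^ q <= 1 + a ^+ 2.
Proof.
move=> a0 q0 q1; have [a1|a1] := leP a 1.
  apply: (@le_trans _ _ 1); last by rewrite lerDl sqr_ge0.
  have -> : (1 : R) = 1 `^ q by rewrite powR1.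
  by apply: ge0_ler_powR; rewrite ?nnegrE ?(ltW q0).
apply: (@le_trans _ _ a); first by apply: ler1_powR => //; exact: ltW.
nra.
Qed.

End powR_inequalities.

Section energy.
Context (R : realType) (N : nat) (s p : R).
Hypotheses (p1 : 1 < p) (p2 : p < 2).
Local Notation E := (euclidean R N).
Local Notation mu := (lebesgue_measure_tuple R N).
Implicit Types (u v g : E -> R).

Let p0 : 0 < p. Proof. exact: lt_trans ltr01 p1. Qed.
Let q0 : 0 < p - 1. Proof. by rewrite subr_gt0. Qed.
Let q1 : p - 1 <= 1. Proof. by rewrite lerBlDr ltW. Qed.

Definition gagliardo_density u (x y : E) : R :=
  `|u x - u y| `^ p / eucl_dist x y `^ (N%:R + s * p).

Lemma gagliardo_density_ge0 u x y : 0 <= gagliardo_density u x y.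
Proof. by rewrite divr_ge0 ?powR_ge0. Qed.

Lemma measurable_gagliardo_density u : measurable_fun setT u ->
  measurable2 (gagliardo_density u).
Proof.
move=> meas_u; rewrite /measurable2 /gagliardo_density.
under eq_fun do rewrite -powRN.
apply: measurable_funM; last first.
  apply: (measurableT_comp (measurable_powR _)); exact: (@measurable_eucl_dist R N).
apply: (measurableT_comp (measurable_powR _)); apply: measurableT_comp => //.
apply: measurable_funB; first exact: (measurableT_comp meas_u measurable_fst).
exact: (measurableT_comp meas_u measurable_snd).
Qed.

Lemma gagliardo_energyE u :
  gagliardo_energy s p u = ((2 * p)^-1%:E * integral2 mu (gagliardo_density u))%E.
Proof. by []. Qed.

Lemma gagliardo_energy_contraction w h : w \in Lfun mu 2%:E ->
  h \in Lfun mu 2%:E -> (forall x y, `|h x - h y| <= `|w x - w y|) ->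
  (gagliardo_energy s p h <= gagliardo_energy s p w)%E.
Proof.
move=> w2 h2 hw; rewrite (gagliardo_energyE h) (gagliardo_energyE w).
apply: lee_wpmul2l; first by rewrite lee_fin invr_ge0 mulr_ge0// ltW.
apply: integral2_le.
- exact: measurable_gagliardo_density (Lfun_measurable h2).
- exact: measurable_gagliardo_density (Lfun_measurable w2).
- exact: gagliardo_density_ge0.
- move=> x y; rewrite /gagliardo_density ler_wpM2r ?invr_ge0 ?powR_ge0//.
  by apply: ge0_ler_powR; rewrite ?nnegrE ?(ltW p0).
Qed.

Variables (rho c : R).
Hypotheses (rho0 : 0 < rho) (c0 : 0 <= c).
Local Notation K := (tent_kernel (s * p) rho).
Hypothesis Kc : forall x : E, (\int[mu]_y (K x y)%:E <= c%:E)%E.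
Local Notation W := (kernel_mass mu K).

Let K0 (x y : E) : 0 <= K x y := tent_kernel_ge0 (s * p) rho x y.
Let KC (x y : E) : K x y = K y x := tent_kernelC (s * p) rho x y.
Let mK : measurable2 (K : E -> E -> R) := @measurable_tent_kernel R N (s * p) rho.
Let mW : measurable_fun setT W := measurable_kernel_mass K0 mK Kc.
Let W0 (x : E) : 0 <= W x := kernel_mass_ge0 mu K0 x.
Let Wc (x : E) : W x <= c := kernel_mass_le K0 Kc x.

Lemma integral_tent_kernel_mass_le :
  (\int[mu]_x (W x)%:E <= (2 * (c * (2 * rho) ^+ N))%:E)%E.
Proof.
apply: (integral_kernel_mass_le c0 K0 KC mK Kc (S := cube [tuple 0 | i < N] rho)).
- exact: measurable_cube.
- by rewrite cube_measure.
- move=> x y Sx Sy.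
  have t0 z : ~ cube [tuple 0 | i < N] rho z -> tent rho z = 0.
    by move=> Sz; apply/eqP; apply: contra_notT Sz; exact: tent_cube.
  by rewrite /tent_kernel !t0// subrr normr0 mul0r.
Qed.

Lemma integrable_tent_kernel_mass : mu.-integrable setT (EFin \o W).
Proof.
apply/integrableP; split; first exact/measurable_EFinP.
under eq_integral do rewrite /= ger0_norm//.
by apply: (le_lt_trans integral_tent_kernel_mass_le); rewrite ltry.
Qed.

Lemma integrable_sqr_mass v : v \in Lfun mu 2%:E ->
  mu.-integrable setT (EFin \o (fun x => v x ^+ 2 * W x)).
Proof.
move=> v2; have mv := Lfun_measurable v2.
have i2 := integrableZl measurableT c (Lfun2_integrable2 v2).
apply: le_integrable i2 => //.
  by apply/measurable_EFinP; apply: measurable_funM => //; exact: measurable_funX.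
move=> x _ /=; rewrite lee_fin.
rewrite (ger0_norm (mulr_ge0 (sqr_ge0 _) (W0 x))) (ger0_norm (mulr_ge0 c0 (sqr_ge0 _))).
by rewrite mulrC ler_wpM2r// sqr_ge0.
Qed.

(** An upper bound, up to a factor 2, for the rate at which v transports
    mass through the slope of the cutoff. *)
Definition tent_flux v : R := \int[mu]_x (`|v x| `^ (p - 1) * W x).

Lemma integrable_flux v : v \in Lfun mu 2%:E ->
  mu.-integrable setT (EFin \o (fun x => `|v x| `^ (p - 1) * W x)).
Proof.
move=> v2; have mv := Lfun_measurable v2.
have i := integrableD measurableT integrable_tent_kernel_mass (integrable_sqr_mass v2).
apply: le_integrable i => //.
  apply/measurable_EFinP; apply: measurable_funM => //.
  by apply: (measurableT_comp (measurable_powR _)); exact: measurableT_comp.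
move=> x _ /=; rewrite lee_fin (ger0_norm (mulr_ge0 (powR_ge0 _ _) (W0 x))).
rewrite (ger0_norm (addr_ge0 (W0 x) (mulr_ge0 (sqr_ge0 _) (W0 x)))).
have -> : W x + v x ^+ 2 * W x = (1 + v x ^+ 2) * W x by ring.
rewrite ler_wpM2r//.
by rewrite -(real_normK (num_real (v x))) powR_le_sqr.
Qed.

Lemma tent_flux_ge0 v : 0 <= tent_flux v.
Proof. by apply: Rintegral_ge0 => x _; exact: mulr_ge0 (powR_ge0 _ _) (W0 x). Qed.

Lemma Lfun2_tent : tent rho \in Lfun mu 2%:E.
Proof.
apply/Lfun2P; split; first exact: measurable_tent.
pose S : set E := cube [tuple 0 | i < N] rho.
have mS : measurable S by exact: measurable_cube.
apply: (@le_lt_trans _ _ (\int[mu]_x (\1_S x)%:E)%E).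
  apply: ge0_le_integral => //.
  - by move=> x _; rewrite lee_fin sqr_ge0.
  - by apply/measurable_EFinP; apply: measurable_funX; exact: measurable_tent.
  - by apply/measurable_EFinP; exact: measurable_indic.
  - move=> x _; rewrite lee_fin; have [->|tx] := eqVneq (tent rho x) 0.
      by rewrite expr0n.
    rewrite indicE mem_set; last exact: tent_cube.
    by rewrite expr_le1// ?tent_ge0 ?tent_le1.
by rewrite integral_indic// setIT [ltLHS](cube_measure _ rho0) ltry.
Qed.

Lemma density_perturbation v (tau lam : R) x y : `|tau| = 1 -> 0 < lam ->
  gagliardo_density (fun x => v x + lam * (tau * tent rho x)) x y <=
  gagliardo_density v x y + (K x y * (2 * lam * `|v x| `^ (p - 1)) +
   (K x y * (2 * lam * `|v y| `^ (p - 1)) + K x y * lam `^ p)).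
Proof.
move=> tau1 lam0; rewrite /gagliardo_density /tent_kernel.
set D := _ `^ (N%:R + s * p).
have D0 : 0 <= D^-1 by rewrite invr_ge0 powR_ge0.
pose b := `|tent rho x - tent rho y|.
have b0 : 0 <= b by exact: normr_ge0.
have b1 : b <= 1 by exact: tent_dist1.
have lb0 : 0 <= lam * b by rewrite mulr_ge0// ltW.
suff h : `|v x + lam * (tau * tent rho x) - (v y + lam * (tau * tent rho y))| `^ p <=
    `|v x - v y| `^ p + b * (2 * lam * `|v x| `^ (p - 1) +
     (2 * lam * `|v y| `^ (p - 1) + lam `^ p)).
  apply: (@le_trans _ _ ((`|v x - v y| `^ p + b * (2 * lam * `|v x| `^ (p - 1) +
     (2 * lam * `|v y| `^ (p - 1) + lam `^ p))) * D^-1)); first by rewrite ler_wpM2r.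
  by rewrite -/b le_eqVlt; apply/orP; left; apply/eqP; ring.
apply: (@le_trans _ _ ((`|v x - v y| + lam * b) `^ p)).
  apply: ge0_ler_powR; rewrite ?nnegrE ?(ltW p0) ?(ltW q0) ?addr_ge0//.
  have -> : v x + lam * (tau * tent rho x) - (v y + lam * (tau * tent rho y)) =
    (v x - v y) + lam * tau * (tent rho x - tent rho y) by ring.
  apply: le_trans (ler_normD _ _) _; rewrite lerD2l.
  by rewrite !normrM tau1 mulr1 gtr0_norm.
apply: le_trans (powR_expand_le (normr_ge0 _) lb0 p1 p2) _.
rewrite lerD2l.
have h1 : `|v x - v y| `^ (p - 1) <= `|v x| `^ (p - 1) + `|v y| `^ (p - 1).
  apply: le_trans (powRD_le (normr_ge0 _) (normr_ge0 _) q0 q1).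
  apply: ge0_ler_powR; rewrite ?nnegrE ?(ltW p0) ?(ltW q0) ?addr_ge0//.
  by rewrite ler_normB.
have h2 : (lam * b) `^ (p - 1) <= lam `^ (p - 1).
  apply: ge0_ler_powR; rewrite ?nnegrE ?(ltW lam0) ?(ltW q0)//.
  by rewrite ler_piMr// ltW.
rewrite -(mulr_powRB1 (ltW lam0) p0).
apply: (@le_trans _ _ (lam * b * (2 * (`|v x| `^ (p - 1) + `|v y| `^ (p - 1)) + lam
    `^ (p - 1)))).
  by rewrite ler_wpM2l// lerD// ler_pM2l.
by rewrite le_eqVlt; apply/orP; left; apply/eqP; ring.
Qed.

Lemma energy_perturbation v (tau lam : R) : v \in Lfun mu 2%:E ->
  `|tau| = 1 -> 0 < lam ->
  (gagliardo_energy s p (fun x => v x + lam * (tau * tent rho x))%R <=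
   gagliardo_energy s p v +
   ((2 * p)^-1 * (4 * lam * tent_flux v + lam `^ p * \int[mu]_x W x))%:E)%E.
Proof.
move=> v2 tau1 lam0; rewrite (gagliardo_energyE v) gagliardo_energyE.
have mv := Lfun_measurable v2.
have mvq : measurable_fun setT (fun x => 2 * lam * `|v x| `^ (p - 1)).
  apply: measurable_funM => //.
  by apply: (measurableT_comp (measurable_powR _)); exact: measurableT_comp.
have vq0 x : 0 <= 2 * lam * `|v x| `^ (p - 1).
  by rewrite mulr_ge0 ?powR_ge0// mulr_ge0// ltW.
have lp0 := powR_ge0 lam p.
have h2p : 0 <= (2 * p)^-1 by rewrite invr_ge0 mulr_ge0// ltW.
have m1 := measurable_gagliardo_density mv.
have m2 := measurable_kernel_l mK mvq.
have m3 := measurable_kernel_r mK mvq.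
have m4 : measurable2 (fun x y : E => K x y * lam `^ p).
  exact: (measurable_kernel_l mK (measurable_cst (lam `^ p))).
have m34 : measurable2 (fun x y : E => K x y * (2 * lam * `|v y| `^ (p - 1)) + K x y
    * lam `^ p).
  exact: measurable_funD.
have m234 : measurable2 (fun x y : E => K x y * (2 * lam * `|v x| `^ (p - 1)) +
   (K x y * (2 * lam * `|v y| `^ (p - 1)) + K x y * lam `^ p)).
  exact: measurable_funD.
have -> : ((2 * p)^-1 * (4 * lam * tent_flux v + lam `^ p * \int[mu]_x W x))%:E =
  ((2 * p)^-1%:E * (4 * lam * tent_flux v + lam `^ p * \int[mu]_x W x)%:E)%E by [].
rewrite -ge0_muleDr; last 2 first.
- apply: integral_ge0 => x _; apply: integral_ge0 => y _.
  by rewrite lee_fin gagliardo_density_ge0.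
- rewrite lee_fin addr_ge0 ?mulr_ge0 ?tent_flux_ge0 ?(ltW lam0)//.
  by apply: Rintegral_ge0 => x _.
apply: lee_wpmul2l; first by rewrite lee_fin.
apply: (@le_trans _ _ (integral2 mu (fun x y => gagliardo_density v x y +
   (K x y * (2 * lam * `|v x| `^ (p - 1)) +
   (K x y * (2 * lam * `|v y| `^ (p - 1)) + K x y * lam `^ p))))).
  apply: integral2_le.
  - apply: measurable_gagliardo_density; apply: measurable_funD => //.
    by do 2!apply: measurable_funM => //; exact: measurable_tent.
  - exact: measurable_funD.
  - exact: gagliardo_density_ge0.
  - by move=> x y; exact: density_perturbation.
have k1 (x y : E) : 0 <= K x y * (2 * lam * `|v x| `^ (p - 1)) by exact: mulr_ge0 (K0
    x y) (vq0 x).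
have k2 (x y : E) : 0 <= K x y * (2 * lam * `|v y| `^ (p - 1)) by exact: mulr_ge0 (K0
    x y) (vq0 y).
have k3 (x y : E) : 0 <= K x y * lam `^ p by exact: mulr_ge0 (K0 x y) lp0.
rewrite integral2D//; last 2 first.
- exact: gagliardo_density_ge0.
- by move=> x y; exact: addr_ge0 (k1 x y) (addr_ge0 (k2 x y) (k3 x y)).
rewrite integral2D//; last by move=> x y; exact: addr_ge0 (k2 x y) (k3 x y).
rewrite integral2D// (integral_kernel_l K0 mK Kc mvq vq0).
rewrite (integral_kernel_r K0 KC mK Kc mvq vq0).
rewrite (integral_kernel_l (u := fun=> lam `^ p) K0 mK Kc)//.
have -> : (\int[mu]_x (2 * lam * `|v x| `^ (p - 1) * W x)%:E = (2 * lam * tent_flux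
    v)%:E)%E.
  under eq_integral do rewrite -mulrA EFinM.
  rewrite integralZl//; last exact: integrable_flux.
  rewrite [RHS]EFinM fineK//; apply: integrable_fin_num => //; exact: integrable_flux.
have -> : (\int[mu]_x (lam `^ p * W x)%:E = (lam `^ p * \int[mu]_x W x)%:E)%E.
  under eq_integral do rewrite EFinM.
  rewrite integralZl//; last exact: integrable_tent_kernel_mass.
  rewrite [RHS]EFinM fineK//; apply: integrable_fin_num => //; exact:
      integrable_tent_kernel_mass.
rewrite -!EFinD leeD2l// lee_fin le_eqVlt; apply/orP; left; apply/eqP; ring.
Qed.

(** The energy of v - lam sg phi exceeds that of v by at most 2 lam times
    the flux plus a term of order lam^p.  Dividing by lam and letting lam
    tend to 0 removes the latter, since p > 1. *)
Lemma subgradient_flux_le v g (sg : R) : `|sg| = 1 -> g \in Lfun mu 2%:E ->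
  subdifferential mu (gagliardo_energy s p) v (\- g) ->
  \int[mu]_x (sg * tent rho x * g x) <= 2 * tent_flux v.
Proof.
move=> sg1 g2 [v2 _ fin sub].
have t2 := Lfun2_tent.
have st2 := Lfun2_Z (- sg) t2.
have i1 : mu.-integrable setT (EFin \o (fun x => sg * tent rho x * g x)).
  by apply: Lfun2_integrableM => //; exact: Lfun2_Z.
set I := \int[mu]_x _.
pose w := \int[mu]_x W x.
have w0 : 0 <= w by apply: Rintegral_ge0 => x _.
have key lam : 0 < lam -> I <= 2 * tent_flux v + lam `^ (p - 1) * w.
  move=> lam0.
  have h2 : (fun x => v x + lam * (- sg * tent rho x)) \in Lfun mu 2%:E.
    by apply: Lfun2_D => //; exact: Lfun2_Z.
  have := le_trans (sub _ h2) (energy_perturbation (tau := - sg) v2 _ lam0).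
  rewrite normrN sg1 => /(_ erefl).
  rewrite leeD2lE//.
  have -> : (\int[mu]_x ((\- g) x * (v x + lam * (- sg * tent rho x) - v x))%:E =
      (lam * I)%:E)%E.
    rewrite /I -RintegralZl//= fineK; last first.
      apply: integrable_fin_num => //.
      by have := integrableZl measurableT lam i1; apply: eq_integrable.
    by apply: eq_integral => x _; congr EFin; ring.
  rewrite lee_fin -(mulr_powRB1 (ltW lam0) p0) -/w => h.
  have F0 := tent_flux_ge0 v.
  have q0' := powR_ge0 lam (p - 1).
  have h3 : (2 * p)^-1 <= 1 / 2.
    by rewrite div1r lef_pV2 ?posrE ?mulr_gt0// ler_peMr// ltW.
  have h4 : lam * I <= 1 / 2 * (4 * lam * tent_flux v + lam * lam `^ (p - 1) * w).
    apply: le_trans h _; rewrite ler_wpM2r// addr_ge0 ?mulr_ge0// ?(ltW lam0)//.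
  rewrite -(ler_pM2l lam0); apply: le_trans h4 _.
  have : 0 <= lam * lam `^ (p - 1) * w by rewrite !mulr_ge0// ltW.
  lra.
apply/ler_addgt0Pr => e e0.
(* The value of lam below is chosen so that lam^(p - 1) = e / (w + 1). *)
have ew : 0 < e / (w + 1) by rewrite divr_gt0// ltr_wpDl.
have := key ((e / (w + 1)) `^ (p - 1)^-1); rewrite powR_gt0// => /(_ isT).
rewrite -powRrM mulVf ?gt_eqF// powRr1 ?(ltW ew)//.
move=> h; apply: le_trans h _; rewrite lerD2l.
by rewrite mulrAC ler_pdivrMr ?ltr_wpDl// ler_pM2l// lerDl.
Qed.

End energy.

(** * Estimates of the flux *)

Section powR_splitting.
Context (R : realType) (q : R).
Hypotheses (q0 : 0 < q) (q1 : q <= 1).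

(** Below theta the power is at most theta^q; above theta it is at most
    linear, as q <= 1. *)
Lemma powR_le_affine (a theta : R) : 0 <= a -> 0 < theta ->
  a `^ q <= theta `^ q + theta `^ q / theta * a.
Proof.
move=> a0 t0; have [at_|ta] := leP a theta.
  apply: (@le_trans _ _ (theta `^ q)).
    by apply: ge0_ler_powR; rewrite ?nnegrE ?(ltW q0) ?(ltW t0).
  by rewrite lerDl mulr_ge0// divr_ge0 ?powR_ge0// ltW.
apply: ler_wpDl; first exact: powR_ge0.
have a1 : 1 <= a / theta by rewrite ler_pdivlMr// mul1r ltW.
have -> : a `^ q = theta `^ q * (a / theta) `^ q.
  rewrite -powRM ?(ltW t0) ?(le_trans ler01 a1)//; congr (_ `^ _); field.
  by rewrite gt_eqF.
rewrite -mulrA ler_wpM2l ?powR_ge0// [leRHS]mulrC.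
exact: ler1_powR.
Qed.

(** Makes the flux continuous for the L2 norm although the power q < 1 is
    not Lipschitz at 0. *)
Lemma powR_le_eps_sqr (e : R) : 0 < e ->
  exists2 C : R, 0 < C & forall a, 0 <= a -> a `^ q <= e + C * a ^+ 2.
Proof.
move=> e0; pose theta := e `^ q^-1.
have t0 : 0 < theta by rewrite powR_gt0.
have tq : theta `^ q = e by rewrite -powRrM mulVf ?gt_eqF// powRr1// ltW.
exists (1 + (theta ^+ 2)^-1) => [|a a0].
  by rewrite ltr_pwDl// invr_ge0 exprn_ge0// ltW.
have C0 : 0 <= (1 + (theta ^+ 2)^-1) * a ^+ 2.
  by rewrite mulr_ge0 ?sqr_ge0// addr_ge0// invr_ge0 exprn_ge0// ltW.
have [at_|ta] := leP a theta.
  apply: (@le_trans _ _ e); last by rewrite lerDl.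
  by rewrite -tq; apply: ge0_ler_powR; rewrite ?nnegrE ?(ltW q0) ?(ltW t0).
apply: ler_wpDl; first exact: ltW.
apply: (le_trans (powR_le_sqr a0 q0 q1)); rewrite mulrDl mul1r addrC lerD2l.
rewrite mulrC ler_pdivlMr ?exprn_gt0// mul1r.
by rewrite lerXn2r ?nnegrE// ltW.
Qed.

Lemma powR_dist_le (a b : R) : `|a| `^ q <= `|b| `^ q + `|a - b| `^ q.
Proof.
apply: le_trans (powRD_le (normr_ge0 _) (normr_ge0 _) q0 q1).
apply: ge0_ler_powR; rewrite ?nnegrE ?(ltW q0) ?addr_ge0//.
by apply: le_trans (ler_normD _ _); rewrite (addrC b) subrK.
Qed.

End powR_splitting.

Section flux_estimates.
Context (R : realType) (N : nat) (s p : R).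
Hypotheses (p1 : 1 < p) (p2 : p < 2).
Local Notation E := (euclidean R N).
Local Notation mu := (lebesgue_measure_tuple R N).
Implicit Types (u v g : E -> R).

Let q0 : 0 < p - 1. Proof. by rewrite subr_gt0. Qed.
Let q1 : p - 1 <= 1. Proof. by rewrite lerBlDr ltW. Qed.

Variables (rho c : R).
Hypotheses (rho0 : 0 < rho) (c0 : 0 <= c).
Local Notation K := (tent_kernel (s * p) rho).
Hypothesis Kc : forall x : E, (\int[mu]_y (K x y)%:E <= c%:E)%E.
Local Notation W := (kernel_mass mu K).

Let K0 (x y : E) : 0 <= K x y := tent_kernel_ge0 (s * p) rho x y.
Let mK : measurable2 (K : E -> E -> R) := @measurable_tent_kernel R N (s * p) rho.
Let mW : measurable_fun setT W := measurable_kernel_mass K0 mK Kc.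
Let W0 (x : E) : 0 <= W x := kernel_mass_ge0 mu K0 x.
Let Wc (x : E) : W x <= c := kernel_mass_le K0 Kc x.
Let iW : mu.-integrable setT (EFin \o W).
Proof. exact: integrable_tent_kernel_mass rho0 c0 Kc. Qed.

Lemma tent_flux_continuous e : 0 < e -> exists2 C : R, 0 < C &
  forall u v, u \in Lfun mu 2%:E -> v \in Lfun mu 2%:E ->
    `|tent_flux s p rho u - tent_flux s p rho v| <=
      e + C * nrm2 mu (fun x => u x - v x) ^+ 2.
Proof.
move=> e0; pose w := \int[mu]_x W x.
have w0 : 0 <= w by apply: Rintegral_ge0 => x _.
have ew : 0 < e / (w + 1) by rewrite divr_gt0// ltr_wpDl.
have [C C0 hC] := powR_le_eps_sqr q0 q1 ew.
exists (C * c + 1) => [|u v u2 v2]; first by rewrite ltr_wpDl// mulr_ge0// ltW.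
have half u' v' : u' \in Lfun mu 2%:E -> v' \in Lfun mu 2%:E ->
    tent_flux s p rho u' - tent_flux s p rho v' <=
      e + (C * c + 1) * nrm2 mu (fun x => u' x - v' x) ^+ 2.
  move=> u2' v2'; have d2 := Lfun2_B u2' v2'.
  have iu := integrable_flux p1 p2 rho0 c0 Kc u2'.
  have iv := integrable_flux p1 p2 rho0 c0 Kc v2'.
  have isq := Lfun2_integrable2 d2.
  rewrite nrm2_sqr// /tent_flux -RintegralB//.
  have i1 : mu.-integrable setT (EFin \o (fun x => e / (w + 1) * W x)).
    by have := integrableZl measurableT (e / (w + 1)) iW; apply: eq_integrable.
  have i2 : mu.-integrable setT (EFin \o (fun x => C * c * (u' x - v' x) ^+ 2)).
    by have := integrableZl measurableT (C * c) isq; apply: eq_integrable.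
  apply: (@le_trans _ _ (\int[mu]_x (e / (w + 1) * W x + C * c * (u' x - v' x) ^+ 2))).
    apply: le_Rintegral => //.
    - by have := integrableB measurableT iu iv; apply: eq_integrable.
    - by have := integrableD measurableT i1 i2; apply: eq_integrable.
    - move=> x _; rewrite -mulrBl.
      apply: (@le_trans _ _ (`|u' x - v' x| `^ (p - 1) * W x)).
        by rewrite ler_wpM2r// lerBlDl; exact: powR_dist_le.
      have h := hC _ (normr_ge0 (u' x - v' x)).
      rewrite real_normK ?num_real// in h.
      apply: (le_trans (ler_wpM2r (W0 x) h)); rewrite mulrDl lerD2l.
      rewrite [leRHS]mulrAC; apply: ler_wpM2l => //.
      by apply: mulr_ge0 (ltW C0) (sqr_ge0 _).
  rewrite RintegralD// RintegralZl// RintegralZl//.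
  apply: lerD.
    rewrite mulrAC ler_pdivrMr ?ltr_wpDl// ler_pM2l// -/w lerDl//.
  rewrite ler_wpM2r ?lerDl//; apply: Rintegral_ge0 => x _; exact: sqr_ge0.
rewrite ler_norml half// andbT lerNl opprB nrm2_BC//.
exact: half.
Qed.

(** On B the power is estimated by 1 + |v|, which is integrable there
    because B has finite measure; off B by the affine bound at level theta. *)
Lemma tent_flux_split v (B : set E) (m theta : R) : v \in Lfun mu 2%:E ->
  v \in Lfun mu 1%E -> measurable B -> (mu B <= m%:E)%E -> 0 < theta ->
  tent_flux s p rho v <=
    c * (\int[mu]_x `|v x| + m) +
    theta `^ (p - 1) / theta * c * \int[mu]_(x in ~` B) `|v x| +
    theta `^ (p - 1) * (2 * (c * (2 * rho) ^+ N)).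
Proof.
move=> v2 v1 mB Bm t0.
have mv := Lfun_measurable v1.
have iv : mu.-integrable setT (EFin \o (fun x => `|v x|)).
  have /Lfun1_integrable := v1 => /integrable_norm.
  by apply: eq_integrable.
have mBC : measurable (~` B) by exact: measurableC.
have iB : mu.-integrable setT (EFin \o (\1_B : E -> R)).
  apply/integrableP; split; first by apply/measurable_EFinP; exact: measurable_indic.
  under eq_integral do rewrite /= ger0_norm//.
  by rewrite integral_indic// setIT; exact: le_lt_trans Bm (ltry _).
pose k := theta `^ (p - 1) / theta * c.
have tq0 := powR_ge0 theta (p - 1).
have k0 : 0 <= k by rewrite mulr_ge0// divr_ge0// ltW.
have ivB : mu.-integrable setT (EFin \o (fun x => `|v x| * \1_(~` B) x)).
  apply: le_integrable iv => //.
    apply/measurable_EFinP; apply: measurable_funM; first exact: measurableT_comp.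
    exact: measurable_indic.
  move=> x _ /=; rewrite lee_fin normrM normr_id ler_piMr//.
  by rewrite indicE; case: (_ \in _); rewrite ?normr1 ?normr0.
have i1 : mu.-integrable setT (EFin \o (fun x => c * (`|v x| + \1_B x))).
  have := integrableZl measurableT c (integrableD measurableT iv iB).
  by apply: eq_integrable.
have i2 : mu.-integrable setT (EFin \o (fun x => k * (`|v x| * \1_(~` B) x))).
  by have := integrableZl measurableT k ivB; apply: eq_integrable.
have i3 : mu.-integrable setT (EFin \o (fun x => theta `^ (p - 1) * W x)).
  by have := integrableZl measurableT (theta `^ (p - 1)) iW; apply: eq_integrable.
have i12 : mu.-integrable setT (EFin \o (fun x => c * (`|v x| + \1_B x) + k * (`|v x|
    * \1_(~` B) x))).
  by have := integrableD measurableT i1 i2; apply: eq_integrable.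
apply: (@le_trans _ _ (\int[mu]_x (c * (`|v x| + \1_B x) + k * (`|v x| * \1_(~` B) x)
    + theta `^ (p - 1) * W x))).
  apply: le_Rintegral => //.
  - exact: (integrable_flux p1 p2 rho0 c0 Kc v2).
  - by have := integrableD measurableT i12 i3; apply: eq_integrable.
  - move=> x _; have [Bx|Bx] := pselect (B x).
      rewrite indicE mem_set// indicE memNset//=.
      rewrite !mulr0 addr0; apply: ler_wpDr; first exact: mulr_ge0 tq0 (W0 x).
      rewrite mulrC; apply: (ler_pM (W0 x) (powR_ge0 _ _) (Wc x)).
      have := powR_le_affine q0 q1 (normr_ge0 (v x)) ltr01.
      by rewrite powR1 divr1 mul1r => h; rewrite [leRHS]addrC.
    rewrite indicE memNset// indicE mem_set// addr0 mulr1.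
    rewrite -addrA; apply: ler_wpDl; first by rewrite mulr_ge0.
    have h := powR_le_affine q0 q1 (normr_ge0 (v x)) t0.
    apply: (le_trans (ler_wpM2r (W0 x) h)); rewrite mulrDl [leLHS]addrC lerD2r.
    rewrite /k mulrAC ler_wpM2r// ler_wpM2l//.
    by rewrite divr_ge0// ltW.
rewrite RintegralD// RintegralD// RintegralZl//; last first.
  by have := integrableD measurableT iv iB; apply: eq_integrable.
rewrite RintegralZl// RintegralZl// RintegralD//.
apply: lerD; first apply: lerD.
- rewrite ler_wpM2l// lerD2l -lee_fin fineK; last exact: integrable_fin_num.
  by rewrite integral_indic// setIT.
- rewrite ler_wpM2l// [leRHS]Rintegral_mkcond le_eqVlt; apply/orP; left; apply/eqP.
  apply: eq_Rintegral => x _; rewrite /patch indicE.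
  by case: (_ \in _); rewrite ?mulr1 ?mulr0.
- rewrite ler_wpM2l// -lee_fin fineK; last exact: integrable_fin_num.
  exact: (integral_tent_kernel_mass_le rho0 c0 Kc).
Qed.

End flux_estimates.

(** * Conservation of mass for integrable and square-integrable data *)

Section critical_exponent.
Context (R : realType) (N : nat) (s p : R).
Hypotheses (p1 : 1 < p) (p2 : p < 2) (s0 : 0 < s).
Hypothesis critical : N%:R * (2 - p) = s * p.
Local Notation E := (euclidean R N).
Local Notation mu := (lebesgue_measure_tuple R N).
Implicit Types (u v f : E -> R).

Let q0 : 0 < p - 1. Proof. by rewrite subr_gt0. Qed.
Let sp0 : 0 < s * p. Proof. by rewrite mulr_gt0// (lt_trans ltr01). Qed.

Variable C : R.
Hypothesis C0 : 0 < C.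
Hypothesis hC : forall rho, 0 < rho -> forall x : E,
  (\int[mu]_y (tent_kernel (s * p) rho x y)%:E <= (C * rho `^ (- (s * p)))%:E)%E.

Let c0 rho : 0 <= C * rho `^ (- (s * p)).
Proof. by rewrite mulr_ge0 ?powR_ge0// ltW. Qed.

(** The total exponent, -N (p - 1) - s p + N = N (2 - p) - s p, vanishes at
    the critical p. *)
Lemma critical_scaling rho : 0 < rho ->
  (rho `^ (- N%:R)) `^ (p - 1) * rho `^ (- (s * p)) * rho ^+ N = 1.
Proof.
move=> r0; rewrite -powRrM -powR_mulrn ?ltW// -!powRD ?(gt_eqF r0) ?implybT//.
rewrite -critical.
have -> : - N%:R * (p - 1) + - (N%:R * (2 - p)) + N%:R = 0 by ring.
by rewrite powRr0.
Qed.

(** The previous splitting at level theta = delta rho^(-N).  This is where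
    the critical exponent enters: the terms off B no longer depend on rho. *)
Lemma critical_flux_split v (B : set E) (m delta rho : R) : v \in Lfun mu 2%:E ->
  v \in Lfun mu 1%E -> measurable B -> (mu B <= m%:E)%E -> 0 < delta -> 0 < rho ->
  tent_flux s p rho v <=
    C * rho `^ (- (s * p)) * (\int[mu]_x `|v x| + m) +
    C * (delta `^ (p - 1) / delta) * \int[mu]_(x in ~` B) `|v x| +
    2 * C * 2 ^+ N * delta `^ (p - 1).
Proof.
move=> v2 v1 mB Bm d0 r0.
have rN : 0 < rho `^ (- N%:R) by exact: powR_gt0.
have t0 : 0 < delta * rho `^ (- N%:R) by rewrite mulr_gt0.
apply: le_trans (tent_flux_split p1 p2 r0 (c0 rho) (hC r0) v2 v1 mB Bm t0) _.
have := critical_scaling r0.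
rewrite powRM ?(ltW d0) ?(ltW rN)// exprMn.
have -> : (delta * rho `^ (- N%:R))^-1 = delta^-1 * rho ^+ N.
  by rewrite invfM powRN invrK powR_mulrn// ltW.
move: ((rho `^ (- N%:R)) `^ (p - 1)) (rho `^ (- (s * p))) (rho ^+ N) (delta `^ (p -
    1)) => X Y Z D XYZ.
rewrite le_eqVlt; apply/orP; left; apply/eqP.
have -> : D * X * (delta^-1 * Z) * (C * Y) = C * (D / delta) * (X * Y * Z) by ring.
have -> : D * X * (2 * (C * Y * (2 ^+ N * Z))) = 2 * C * 2 ^+ N * D * (X * Y * Z) by
    ring.
by rewrite XYZ !mulr1.
Qed.

Lemma critical_flux_bound v rho : v \in Lfun mu 2%:E -> v \in Lfun mu 1%E ->
  1 <= rho ->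
  tent_flux s p rho v <= 2 * C * \int[mu]_x `|v x| + 2 * C * 2 ^+ N.
Proof.
move=> v2 v1 r1; have r0 : 0 < rho by exact: lt_le_trans r1.
have mu0 : (mu set0 <= 0%:E)%E by rewrite measure0.
apply: le_trans (critical_flux_split v2 v1 measurable0 mu0 ltr01 r0) _.
rewrite powR1 setC0 divr1 !mulr1 addr0 lerD2r.
have I0 : 0 <= \int[mu]_x `|v x| by apply: Rintegral_ge0.
have Y1 : rho `^ (- (s * p)) <= 1.
  by rewrite -(powRr0 rho); apply: ler_powR => //; rewrite oppr_le0 ltW.
rewrite mulr_natl mulr2n mulrDl lerD2r ler_wpM2r//.
by rewrite ler_piMr// ltW.
Qed.

Lemma L1_tail v (e : R) : v \in Lfun mu 1%E -> 0 < e ->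
  exists2 r : R, 0 < r & \int[mu]_(x in ~` cube [tuple 0 | i < N] r) `|v x| < e.
Proof.
move=> v1 e0; have mv := Lfun_measurable v1.
pose B k : set E := cube [tuple 0 | i < N] k.+1%:R.
have mB k : measurable (~` B k) by apply: measurableC; exact: measurable_cube.
have iv : mu.-integrable setT (EFin \o (fun x => `|v x|)).
  by have /Lfun1_integrable/integrable_norm := v1; apply: eq_integrable.
pose F k x : \bar R := (`|v x| * \1_(~` B k) x)%:E.
have mF k : measurable_fun setT (F k).
  apply/measurable_EFinP; apply: measurable_funM; first exact: measurableT_comp.
  exact: measurable_indic.
have Fcvg : {ae mu, forall x, setT x -> F ^~ x @ \oo --> cst 0%E x}.
  apply: aeW => x _; apply: cvg_near_cst => /=.
  near=> k; rewrite /F indicE memNset ?mulr0//=; apply.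
    move=> i /=; rewrite tnth_mktuple in_itv /= sub0r add0r -ltr_norml.
    apply: (@le_lt_trans _ _ (norm1 x)).
      by rewrite /norm1 (bigD1 i)//= lerDl; apply: sumr_ge0.
    apply: (@lt_trans _ _ k%:R); last by rewrite ltr_nat.
    by near: k; exact: nbhs_infty_gtr.
have Fdom : {ae mu, forall x k, setT x -> (`|F k x| <= (EFin \o (fun x => `|v x|)%R)
    x)%E}.
  apply: aeW => x k _ /=; rewrite lee_fin normrM normr_id ler_piMr//.
  by rewrite indicE; case: (_ \in _); rewrite ?normr1 ?normr0.
have [_ _ cvF] := dominated_convergence measurableT mF (measurable_cst _) Fcvg iv Fdom.
rewrite integral0 in cvF.
have /filter_ex [k hk] : \forall k \near \oo, ([sequence \int[mu]_x F n x]_n k <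
    e%:E)%E.
  exact: cvge0_lt cvF e0.
exists k.+1%:R => //.
rewrite -lte_fin; apply: le_lt_trans hk => /=.
rewrite Rintegral_mkcond fineK; last first.
  apply: integrable_fin_num => //.
  apply: le_integrable iv => //.
    have := mF k; apply: eq_measurable_fun => x _; rewrite /F /patch indicE /=.
    by case: (_ \in _); rewrite ?mulr1 ?mulr0.
  move=> x _ /=; rewrite lee_fin normr_id /patch; case: ifP => _; rewrite ?normr_id
      ?normr0//.
rewrite le_eqVlt; apply/orP; left; apply/eqP; apply: eq_integral => x _.
by rewrite /F /patch indicE /=; case: (_ \in _); rewrite ?mulr1 ?mulr0.
Unshelve. all: by end_near. Qed.

Lemma powR_nat_cvg0 (a e : R) : 0 < a -> 0 < e ->
  \forall n \near \oo, (n.+1%:R : R) `^ (- a) < e.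
Proof.
move=> a0 e0; near=> n.
have h : e^-1 `^ a^-1 < n.+1%:R.
  by apply: (@lt_trans _ _ n%:R); [near: n; exact: nbhs_infty_gtr|rewrite ltr_nat].
have : (e^-1 `^ a^-1) `^ a < n.+1%:R `^ a.
  by apply: gt0_ltr_powR; rewrite ?nnegrE ?powR_ge0.
rewrite -powRrM mulVf ?gt_eqF// powRr1 ?invr_ge0 ?(ltW e0)// => h'.
by rewrite powRN -[ltRHS]invrK ltf_pV2 ?posrE ?invr_gt0// powR_gt0.
Unshelve. all: by end_near. Qed.

(** The three terms are made small one after the other: first delta, then
    the cube that carries almost all of the mass, then n. *)
Lemma critical_flux_cvg0 v (e : R) : v \in Lfun mu 2%:E -> v \in Lfun mu 1%E ->
  0 < e -> \forall n \near \oo, tent_flux s p n.+1%:R v < e.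
Proof.
move=> v2 v1 e0.
have e3 : 0 < e / 3 by rewrite divr_gt0.
pose A := 2 * C * 2 ^+ N.
have A0 : 0 < A by rewrite !mulr_gt0// exprn_gt0.
pose delta := (e / 3 / A) `^ (p - 1)^-1.
have d0 : 0 < delta by rewrite powR_gt0// divr_gt0.
have dq : delta `^ (p - 1) = e / 3 / A.
  by rewrite -powRrM mulVf ?gt_eqF// powRr1// ltW// divr_gt0.
pose k := C * (delta `^ (p - 1) / delta).
have k0 : 0 < k by rewrite mulr_gt0// divr_gt0// powR_gt0.
have [r r0 tail] := L1_tail v1 (divr_gt0 e3 k0).
pose m := \int[mu]_x `|v x| + (2 * r) ^+ N.
have m0 : 0 <= m.
  by rewrite addr_ge0//; [apply: Rintegral_ge0|rewrite exprn_ge0// mulr_ge0// ltW].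
have Cm : 0 < C * (m + 1) by rewrite mulr_gt0// ltr_wpDl.
near=> n.
have n0 : 0 < n.+1%:R :> R by [].
have mS : measurable (cube [tuple 0 | i < N] r) by exact: measurable_cube.
have cB : (mu (cube [tuple 0%R | i < N] r) <= ((2 * r) ^+ N)%:E)%E by rewrite
    cube_measure.
apply: le_lt_trans (critical_flux_split v2 v1 mS cB d0 n0) _.
have Y : n.+1%:R `^ (- (s * p)) < e / 3 / (C * (m + 1)).
  by near: n; apply: powR_nat_cvg0 => //; rewrite divr_gt0.
rewrite -/m -/k dq -/A.
have h1 : A * (e / 3 / A) = e / 3 by rewrite mulrC mulfVK// gt_eqF.
have h2 : k * \int[mu]_(x in ~` cube [tuple 0 | i < N] r) `|v x| < e / 3.
  by rewrite mulrC -ltr_pdivlMr.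
have h3 : C * n.+1%:R `^ (- (s * p)) * m <= e / 3.
  apply: (@le_trans _ _ (n.+1%:R `^ (- (s * p)) * (C * (m + 1)))).
    rewrite mulrAC [leRHS]mulrC ler_wpM2r ?powR_ge0// ler_wpM2l ?(ltW C0)//.
    by rewrite lerDl.
  by rewrite -ler_pdivlMr// ltW.
rewrite h1; clear -h2 h3; lra.
Unshelve. all: by end_near. Qed.

Lemma tent_cvg1 (x : E) : tent n.+1%:R x @[n --> \oo] --> (1 : R).
Proof.
have h : norm1 x / n.+1%:R @[n --> \oo] --> (0 : R).
  rewrite -(mulr0 (norm1 x)); apply: cvgM; first exact: cvg_cst.
  exact: cvg_harmonic.
rewrite -[X in _ --> X](_ : Num.max 0 (1 - 0) = 1 :> R); last first.
  by rewrite subr0 max_r.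
apply: (@squeeze_cvgr _ _ _ _ (fun n => 1 - norm1 x / n.+1%:R) (fun=> 1)).
- by apply: nearW => n; rewrite tent_le1// andbT /tent le_max lexx orbT.
- by rewrite max_r ?subr0//; rewrite -[X in _ --> X]subr0; apply: cvgB => //; exact:
      cvg_cst.
- by rewrite max_r ?subr0//; exact: cvg_cst.
Qed.

Lemma integral_tent_cvg v : v \in Lfun mu 1%E ->
  \int[mu]_x (tent n.+1%:R x * v x) @[n --> \oo] --> \int[mu]_x v x.
Proof.
move=> v1; have mv := Lfun_measurable v1.
have iv := v1; move/Lfun1_integrable in iv.
have iav : mu.-integrable setT (EFin \o (fun x => `|v x|)).
  by have /integrable_norm := iv; apply: eq_integrable.
pose F n x : \bar R := (tent n.+1%:R x * v x)%:E.
have mF n : measurable_fun setT (F n).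
  by apply/measurable_EFinP; apply: measurable_funM => //; exact: measurable_tent.
have Fcvg : {ae mu, forall x, setT x -> F ^~ x @ \oo --> (EFin \o v) x}.
  apply: aeW => x _; apply/cvg_EFin; first exact: nearW.
  rewrite -[X in _ --> X]mul1r; apply: cvgM; last exact: cvg_cst.
  exact: tent_cvg1.
have Fdom : {ae mu, forall x k, setT x -> (`|F k x| <= (EFin \o (fun x => `|v x|)%R)
    x)%E}.
  apply: aeW => x k _ /=; rewrite lee_fin normrM ler_piMl//.
  by rewrite ger0_norm ?tent_ge0// tent_le1.
have [_ _ cvF] := dominated_convergence measurableT mF (measurable_int _ iv) Fcvg iav
    Fdom.
apply: fine_cvg; rewrite fineK; last exact: integrable_fin_num.
exact: cvF.
Qed.

Variables (f : E -> R) (v : R -> E -> R).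
Hypothesis flow : L2_gradient_flow mu (gagliardo_energy s p) f v.
Hypothesis f1 : f \in Lfun mu 1%E.

Let flowE0 : ae_eq mu setT (v 0) f. Proof. by have [_ ? _ _ _] := flow. Qed.

Let v0_integral_norm : (\int[mu]_x `|v 0 x|%:E = \int[mu]_x `|f x|%:E)%E.
Proof.
have mv := Lfun_measurable (flow_Lfun2 flow (lexx 0)).
have mf := Lfun_measurable f1.
apply: ge0_ae_eq_integral => //.
- by apply/measurable_EFinP; exact: measurableT_comp.
- by apply/measurable_EFinP; exact: measurableT_comp.
- by apply: filterS flowE0 => x /(_ I) -> _.
Qed.

Lemma critical_flow_L1 t : 0 <= t -> v t \in Lfun mu 1%E /\
  \int[mu]_x `|v t x| <= \int[mu]_x `|f x|.
Proof.
move=> t0.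
have iaf : mu.-integrable setT (EFin \o (fun x => `|f x|)).
  by have /Lfun1_integrable/integrable_norm := f1; apply: eq_integrable.
have foo := integrable_fin_num measurableT iaf.
have le : (\int[mu]_x `|v t x|%:E <= \int[mu]_x `|f x|%:E)%E.
  move: t0; rewrite le_eqVlt => /orP[/eqP <-|t0]; first by rewrite v0_integral_norm.
  apply: (flow_integral_norm_le flow _ f1 t0) => w h.
  exact: gagliardo_energy_contraction.
have mv := Lfun_measurable (flow_Lfun2 flow t0).
have v1 : v t \in Lfun mu 1%E.
  apply/Lfun1_integrable/integrableP; split; first exact/measurable_EFinP.
  by apply: (le_lt_trans le); rewrite ltey_eq foo.
split => //; rewrite /Rintegral; apply: fine_le => //.
apply: integrable_fin_num => //.
by have /Lfun1_integrable/integrable_norm := v1; apply: eq_integrable.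
Qed.

Let flux n t := 2 * tent_flux s p n.+1%:R (v t).

Let flux_continuous n b : {within `[0, b], continuous (flux n)}.
Proof.
have n0 : 0 < n.+1%:R :> R by [].
apply: within_continuous_itv => t /andP[t0 tb] e e0.
have e4 : 0 < e / 4 by rewrite divr_gt0.
have [D D0 hD] := tent_flux_continuous p1 p2 n0 (c0 _) (hC n0) e4.
pose eta := Num.min 1 (e / 4 / D).
have eta0 : 0 < eta by rewrite lt_min ltr01 /= divr_gt0.
have [del del0 hdel] := flow_continuous flow t0 eta0.
exists del => // r /andP[r0 rb] rt.
have r2 := flow_Lfun2 flow r0; have t2 := flow_Lfun2 flow t0.
have h := hD _ _ r2 t2; have := hdel r r0 rt.
have X0 := nrm2_ge0 mu (fun x => v r x - v t x).
move: (nrm2 mu _) X0 h => X X0 h.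
rewrite lt_min => /andP[X1 X2].
have XX : X ^+ 2 <= X by rewrite expr2 ler_piMl// ltW.
have h2 : D * X ^+ 2 < e / 4.
  apply: (@le_lt_trans _ _ (D * X)); first by rewrite ler_wpM2l// ltW.
  by rewrite mulrC -ltr_pdivlMr.
rewrite /flux -mulrBr normrM ger0_norm//.
move: `|_| h => Y h; lra.
Qed.

Let tent_flow_le n b (sg : R) : 0 < b -> `|sg| = 1 ->
  \int[mu]_x (sg * tent n.+1%:R x * v b x) - \int[mu]_x (sg * tent n.+1%:R x * v 0 x) <=
  \int[lebesgue_measure]_(t in `[0, b]) flux n t.
Proof.
move=> b0 sg1; have n0 : 0 < n.+1%:R :> R by [].
have s2 := Lfun2_Z sg (Lfun2_tent N n0).
apply: (@flow_functional_le _ _ _ mu _ f v flow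
  (fun t => \int[mu]_x (sg * tent n.+1%:R x * v t x)) (fun _ x => sg * tent n.+1%:R x)
  (flux n) b (nrm2 mu (fun x => sg * tent n.+1%:R x)) 0 b0 (lexx 0)).
- by move=> t _; split.
- move=> r t /andP[r0 _] /andP[t0 _]; rewrite mul0r addr0.
  have i1 := Lfun2_integrableM s2 (flow_Lfun2 flow r0).
  have i2 := Lfun2_integrableM s2 (flow_Lfun2 flow t0).
  rewrite -RintegralB// le_eqVlt; apply/orP; left; apply/eqP.
  by apply: eq_Rintegral => x _; rewrite mulrBr.
- by move=> t _; rewrite mulr_ge0// tent_flux_ge0.
- exact: flux_continuous.
- move=> t g /andP[t0 _] [g2 _] sub.
  exact: (subgradient_flux_le p1 p2 n0 (c0 _) (hC n0) sg1 g2 sub).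
Qed.

Let flux_integral_cvg0 b : 0 < b ->
  \int[lebesgue_measure]_(t in `[0, b]) flux n t @[n --> \oo] --> (0 : R).
Proof.
move=> b0; pose M := 2 * (2 * C * \int[mu]_x `|f x| + 2 * C * 2 ^+ N).
pose F n t : \bar R := (flux n t)%:E.
have mb : measurable `[0, b]%classic by [].
have v1 t : 0 <= t -> v t \in Lfun mu 1%E by move=> /critical_flow_L1[].
have flux0 n t : 0 <= flux n t.
  have n0 : 0 < n.+1%:R :> R by [].
  by rewrite mulr_ge0// tent_flux_ge0.
have mF n : measurable_fun `[0, b]%classic (F n).
  apply/measurable_EFinP; apply: subspace_continuous_measurable_fun => //.
  exact: flux_continuous.
have Fcvg : {ae lebesgue_measure, forall t, `[0, b]%classic t -> F ^~ t @ \oo --> cst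
    0%E t}.
  apply: aeW => t /=; rewrite in_itv /= => /andP[t0 tb].
  apply/cvg_EFin; first exact: nearW.
  apply/cvgrPdist_lt => e e0; rewrite /= .
  have e2 : 0 < e / 2 by rewrite divr_gt0.
  have := critical_flux_cvg0 (flow_Lfun2 flow t0) (v1 t t0) e2.
  apply: filterS => n hn; rewrite sub0r normrN ger0_norm//.
  by rewrite /flux mulrC -ltr_pdivlMr.
have ib : lebesgue_measure.-integrable `[0, b]%classic (EFin \o (fun=> M)).
  apply: continuous_compact_integrable; first exact: segment_compact.
  by apply: continuous_subspaceT => x; exact: cvg_cst.
have Fdom : {ae lebesgue_measure, forall t n, `[0, b]%classic t ->
    (`|F n t| <= (EFin \o (fun=> M)) t)%E}.
  apply: aeW => t n /=; rewrite in_itv /= => /andP[t0 tb].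
  rewrite lee_fin ger0_norm// /flux ler_pM2l//.
  have [w1 wf] := critical_flow_L1 t0.
  have n1 : 1 <= n.+1%:R :> R by rewrite ler1n.
  apply: le_trans (critical_flux_bound (flow_Lfun2 flow t0) w1 n1) _.
  by rewrite lerD2r ler_pM2l// mulr_gt0.
have [_ _ cvF] := @dominated_convergence _ _ R (@lebesgue_measure R)
  `[0, b]%classic mb F (cst 0%E) (EFin \o (fun=> M)) mF (measurable_cst _) Fcvg ib Fdom.
rewrite integral0 in cvF.
by apply: fine_cvg; exact: cvF.
Qed.

(** The mass seen by the cutoffs tends to the whole mass at both times, and
    its change is bounded, in both directions, by the time integral of the
    flux. *)
Lemma critical_flow_mass b : 0 < b -> \int[mu]_x v b x = \int[mu]_x f x.
Proof.
move=> b0; have [vb1 _] := critical_flow_L1 (ltW b0).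
have [v01 _] := critical_flow_L1 (lexx 0).
transitivity (\int[mu]_x v 0 x); last first.
  congr fine; apply: ae_eq_integral => //.
  - by apply/measurable_EFinP; exact: Lfun_measurable v01.
  - by apply/measurable_EFinP; exact: Lfun_measurable f1.
  - by apply: filterS flowE0 => x /(_ I) /= -> _.
have cD : \int[mu]_x (tent n.+1%:R x * v b x) - \int[mu]_x (tent n.+1%:R x * v 0 x)
    @[n --> \oo] --> \int[mu]_x v b x - \int[mu]_x v 0 x.
  by apply: cvgB; exact: integral_tent_cvg.
apply/eqP; rewrite -subr_eq0; apply/eqP.
rewrite -(cvg_lim (@Rhausdorff R) cD); apply: (cvg_lim (@Rhausdorff R)).
have cF := flux_integral_cvg0 b0.
pose I n := \int[lebesgue_measure]_(t in `[0, b]) flux n t.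
apply: (@squeeze_cvgr _ _ _ _ (fun n => - I n) I); last exact: cF.
  2: by rewrite -oppr0; apply: cvgN; exact: cF.
apply: nearW => n /=; rewrite /I.
have n0 : 0 < n.+1%:R :> R by [].
have t2 := Lfun2_tent N n0.
have vb2 := flow_Lfun2 flow (ltW b0); have v02 := flow_Lfun2 flow (lexx 0).
have h1 := @tent_flow_le n b 1 b0 (normr1 _).
have h2 := @tent_flow_le n b (-1) b0 (normrN1 _).
have e1 w : \int[mu]_x (1 * tent n.+1%:R x * w x) = \int[mu]_x (tent n.+1%:R x * w x).
  by apply: eq_Rintegral => x _; rewrite mul1r.
have e2 w : w \in Lfun mu 2%:E ->
    \int[mu]_x (-1 * tent n.+1%:R x * w x) = - \int[mu]_x (tent n.+1%:R x * w x).
  move=> w2; rewrite -[RHS]mulN1r -RintegralZl//; last exact: Lfun2_integrableM.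
  by apply: eq_Rintegral => x _; rewrite mulrA.
rewrite !e1 in h1; rewrite !e2// in h2.
by apply/andP; split; lra.
Qed.

End critical_exponent.

(** * Passage to the L1 limit *)

Lemma Rintegral_L1norm_lt d (T : measurableType d) (R : realType)
    (mu : {measure set T -> \bar R}) (f g : T -> R) (e : R) :
  f \in Lfun mu 1%E -> g \in Lfun mu 1%E -> (L1norm mu (f \- g)%R < e%:E)%E ->
  `|\int[mu]_x f x - \int[mu]_x g x| < e.
Proof.
move=> /Lfun1_integrable f1 /Lfun1_integrable g1.
have fg1 : mu.-integrable setT (EFin \o (fun x => f x - g x)).
  by have := integrableB measurableT f1 g1; apply: eq_integrable.
rewrite /L1norm Lnorm1 => h; rewrite -RintegralB//.
apply: le_lt_trans (le_normr_Rintegral measurableT fg1) _.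
rewrite -lte_fin fineK//; apply: integrable_fin_num => //.
by have /integrable_norm := fg1; apply: eq_integrable.
Qed.

Theorem theorem9p1 (R : realType) (N : nat) (s p : R)
    (u0 : euclidean R N -> R) (u : R -> euclidean R N -> R)
    (hN : (1 <= N)%N) (hs0 : 0 < s) (hs1 : s < 1)
    (hp : p = 2 * N%:R / (N%:R + s)) (hsp : s * p < 1)
    (hu0 : u0 \in Lfun (lebesgue_measure_tuple R N) 1%E)
    (hu0_ge0 : {ae lebesgue_measure_tuple R N, forall x, 0 <= u0 x})
    (hu : semigroup_solution s p u0 u)
    (hu_ge0 : forall t, 0 < t ->
      {ae lebesgue_measure_tuple R N, forall x, 0 <= u t x}) :
  forall t : R, 0 < t ->
    (\int[lebesgue_measure_tuple R N]_x (u t x)%:E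
     = \int[lebesgue_measure_tuple R N]_x (u0 x)%:E)%E.
Proof.
move=> t t0; set mu := lebesgue_measure_tuple R N.
have N1 : 1 <= N%:R :> R by rewrite ler1n.
have Ns : 0 < N%:R + s by lra.
(* The critical exponent lies strictly between 1 and 2, and N (2 - p) = s p. *)
have critical : N%:R * (2 - p) = s * p by rewrite hp; field; rewrite gt_eqF.
have p1 : 1 < p by rewrite hp ltr_pdivlMr//; lra.
have p2 : p < 2 by rewrite hp ltr_pdivrMr//; lra.
have sp0 : 0 < s * p by rewrite mulr_gt0//; lra.
have [C C0 hC] := tent_kernel_bound N sp0 hsp.
have [_ u1 [f [v [f12 flow fu0 vu]]]] := hu.
have ut1 := u1 t (ltW t0).
have i1 : mu.-integrable setT (EFin \o u t) by exact/Lfun1_integrable.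
have i0 : mu.-integrable setT (EFin \o u0) by exact/Lfun1_integrable.
(* Both integrals are finite, and the mass is continuous for the L1 norm; so
   it suffices to compare both sides with one approximating flow. *)
suff E : \int[mu]_x u t x = \int[mu]_x u0 x.
  rewrite -[LHS]fineK; last exact: integrable_fin_num.
  rewrite -[RHS]fineK; last exact: integrable_fin_num.
  by congr EFin.
apply/eqP; rewrite -subr_eq0 -normr_le0; apply/ler_addgt0Pr => e e0; rewrite add0r.
have e2 : 0 < e / 2 by rewrite divr_gt0.
have [n [hn1 hn2]] : exists n,
    (L1norm mu (f n \- u0)%R < (e / 2)%:E)%E /\
    (L1norm mu (v n t \- u t)%R < (e / 2)%:E)%E.
  near \oo => n; exists n; split; near: n.
    exact: cvge0_lt fu0 e2.
  exact: cvge0_lt (vu t (ltW t0)) e2.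
have fn1 := (f12 n).1.
have [vn1 _] := critical_flow_L1 p1 (flow n) fn1 (ltW t0).
have mass := critical_flow_mass p1 p2 hs0 critical C0 hC (flow n) fn1 t0.
have := Rintegral_L1norm_lt fn1 hu0 hn1; have := Rintegral_L1norm_lt vn1 ut1 hn2.
rewrite mass; move: (\int[mu]_x f n x) (\int[mu]_x u t x) (\int[mu]_x u0 x) => a b c
    h1 h2.
have -> : b - c = - (a - b) + (a - c) by ring.
by apply: le_trans (ler_normD _ _) _; rewrite normrN; lra.
Unshelve. all: by end_near. Qed.
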